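(* Let $\omega$ be a non-principal ultrafilter on $\mathbb N$. Let $(X_i,d_i,\mathfrak m_i,p_i)$, $i\in\mathbb N\cup\{\infty\}$, be pointed Polish metric measure spaces with all $\mathfrak m_i$ boundedly finite. Suppose that $(X_i,d_i,\mathfrak m_i,p_i)\to(X_\infty,d_\infty,\mathfrak m_\infty,p_\infty)$ in the pointed measured Gromov--Hausdorff sense, realized by $(R_i,\varepsilon_i)$-approximations $\psi_i\colon X_i\to X_\infty$ with quasi-inverses $\phi_i\colon X_\infty\to X_i$, and let $\phi_\infty\colon X_\infty\to X_\omega$, $\phi_\infty(x):=[[\phi_i(x)]]$. Then the ultralimit measure $\mathfrak m_\omega$ is concentrated on ${\rm spt}(\mathfrak m_\omega)=\phi_\infty\big({\rm spt}(\mathfrak m_\infty)\big)$ and $$(\phi_\infty)_*\mathfrak m_\infty=\mathfrak m_\omega .$$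
   Context: For a metric space $(X,d)$, $B(x,r)$ is the open ball, $A^r:=\{x:{\rm dist}(x,A)<r\}$, ${\rm Ball}(X)$ is the $\sigma$-algebra generated by open balls (equal to the Borel $\sigma$-algebra if $X$ is separable). A Polish metric measure space is a complete separable metric space with a Borel measure; pointed means a point is chosen; boundedly finite means finite on balls. ${\rm spt}(\mathfrak m):=\{x:\mathfrak m(B(x,r))>0\ \forall r>0\}$; $\mathfrak m$ is concentrated on $A$ if $\mathfrak m(X\setminus A)=0$. $C_{bbs}(X)$ is the set of bounded continuous functions $X\to\mathbb R$ with bounded support. $(R,\varepsilon)$-approximation ($0<\varepsilon<R$) from $(X,d_X,p_X)$ to $(Y,d_Y,p_Y)$: a Borel map $\psi\colon B(p_X,R)\to Y$ with $\psi(p_X)=p_Y$, $\sup_{x,y\in B(p_X,R)}|d_X(x,y)-d_Y(\psi(x),\psi(y))|\le\varepsilon$ and $B(p_Y,R-\varepsilon)\subset\psi(B(p_X,R))^\varepsilon$. Such a map can always be extended in a Borel manner to the whole space $X$, and $(R,\varepsilon)$-approximations are regarded as (so extended) Borel maps $\psi\colon X\to Y$. If $4\varepsilon<R$, a quasi-inverse of $\psi$ is an $(R-\varepsilon,3\varepsilon)$-approximation $\phi\colon Y\to X$ with $d_X(x,\phi(\psi(x)))<3\varepsilon$ for $x\in B(p_X,R-4\varepsilon)$ and $d_Y(y,\psi(\phi(y)))<3\varepsilon$ for $y\in B(p_Y,R-\varepsilon)$ (quasi-inverses exist). Pointed measured Gromov--Hausdorff (pmGH) convergence: there exist $R_i\nearrow+\infty$,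 $\varepsilon_i\searrow0$ and $(R_i,\varepsilon_i)$-approximations $\psi_i\colon X_i\to X_\infty$ such that $(\psi_i)_*\mathfrak m_i\rightharpoonup\mathfrak m_\infty$ in duality with $C_{bbs}(X_\infty)$, i.e. $\int\varphi\circ\psi_i\,d\mathfrak m_i\to\int\varphi\,d\mathfrak m_\infty$ for all $\varphi\in C_{bbs}(X_\infty)$. In the claim, $\psi_i$ are such maps, and $\phi_i$ is a quasi-inverse of $\psi_i$ for all $i$ with $4\varepsilon_i<R_i$. Ultralimit $(X_\omega,d_\omega,\mathfrak m_\omega,p_\omega)$. ''For $\omega$-a.e. $i$'' means for all $i$ in some element of $\omega$. Let $\bar X_\omega$ be the set of families $(x_i)_{i\in S}$, $S\in\omega$, $x_i\in X_i$, modulo equality for $\omega$-a.e. $i$ (classes $[x_i]$); $\bar d_\omega([x_i],[y_i]):=\lim_{i\to\omega}d_i(x_i,y_i)$; $O(\bar X_\omega):=\{[x_i]:\bar d_\omega([x_i],[p_i])<+\infty\}$. $X_\omega$ is the quotient of $O(\bar X_\omega)$ by $\bar d_\omega=0$, with classes $[[x_i]]$, induced distance $d_\omega$, projection $\pi$, and $p_\omega:=[[p_i]]$. For $S\in\omega$, $A_i\in{\rm Ball}(X_i)$, $i\in S$, let $\Pi_{i\to\omega}A_i:=\{[x_i]\in\bar X_\omega:x_i\in A_i\text{ for }\omega\text{-a.e. }i\}$; $\mathcal A_O(\bar X_\omega)$ is the algebra of all sets $(\Pi_{i\to\omega}A_i)\cap O(\bar X_\omega)$, and $\bar{\mathfrak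 m}_\omega\big((\Pi_{i\to\omega}A_i)\cap O(\bar X_\omega)\big):=\lim_{R\to\infty}\lim_{i\to\omega}\mathfrak m_i(A_i\cap B(p_i,R))$. $N\subset O(\bar X_\omega)$ is null ($N\in\mathcal N_\omega$) if for every $\varepsilon>0$ there is $\bar A\in\mathcal A_O(\bar X_\omega)$ with $N\subset\bar A$, $\bar{\mathfrak m}_\omega(\bar A)<\varepsilon$. $\bar{\mathcal B}_\omega$ is the family of $A\subset O(\bar X_\omega)$ such that for every $R>0$ there is $\bar A_R\in\mathcal A_O(\bar X_\omega)$ with $(A\cap\Pi_{i\to\omega}B(p_i,R))\Delta\bar A_R\in\mathcal N_\omega$; for such $A$, $\bar{\mathfrak m}_\omega(A):=\lim_{R\to\infty}\bar{\mathfrak m}_\omega(\bar A_R)$. If for every $R>0$ there is a finite $\eta(R)$ with $\mathfrak m_i(B(p_i,R))\le\eta(R)$ for $\omega$-a.e. $i$ (which holds under pmGH convergence), then $\bar{\mathcal B}_\omega$ is a $\sigma$-algebra, $\bar{\mathfrak m}_\omega$ a measure on it, $\pi^{-1}(A)\in\bar{\mathcal B}_\omega$ for $A\in{\rm Ball}(X_\omega)$, and $\mathfrak m_\omega(A):=\bar{\mathfrak m}_\omega(\pi^{-1}(A))$ for $A\in{\rm Ball}(X_\omega)$. The identity $(\phi_\infty)_*\mathfrak m_\infty=\mathfrak m_\omega$ is between measures on ${\rm Ball}(X_\omega)$.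
   Formalization: In the pmGH convergence, the integral of φ∘ψ_i is taken over B(p_i,R_i) instead of all of X_i; with an arbitrary Borel extension of ψ_i the claim fails, since mass escaping to infinity can be mapped back by the extension. *)

(* Defs.v *)
From HB Require Import structures.
From mathcomp Require Import all_boot all_order all_algebra generic_quotient.
From mathcomp Require Import all_classical all_reals all_analysis.
From mathcomp Require Import lra.

Set Implicit Arguments.
Unset Strict Implicit.
Unset Printing Implicit Defensive.

Import Order.TTheory GRing.Theory Num.Theory.
Import numFieldNormedType.Exports.

Local Open Scope classical_set_scope.
Local Open Scope ring_scope.
Local Open Scope quotient_scope.

HB.mixin Record isSeparable T & Topological T := {
  separable_dense : exists2 D : set T, countable D & dense D }.

(* The distinguished point of a pointed metric space is [point]. *)
#[short(type="ppolishType")]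
HB.structure Definition PointedPolish (R : realType) :=
  {T of CompletePseudoMetric R T & PseudoMetric_isMetric R T & isSeparable T}.

Definition borel (T : ptopologicalType) := g_sigma_algebraType (@open T).

Definition balls (R : realType) (T : metricType R) : set (set T) :=
  [set A | exists x r, A = ball x r].

Definition Ball (R : realType) (T : metricType R) : set (set T) :=
  <<s @balls R T >>.

Record pmmSpace (R : realType) := PmmSpace {
  pmm_space :> ppolishType R ;
  pmm_measure : {measure set (borel pmm_space) -> \bar R} }.

Notation "''m_' X" := (pmm_measure X) (at level 8, X at level 2).

Definition boundedly_finite (R : realType) (X : pmmSpace R) :=
  forall (x : X) (r : R), ('m_X (ball x r) < +oo)%E.

Definition spt (R : realType) (T : metricType R) (m : set T -> \bar R) : set T :=
  [set x | forall r : R, 0 < r -> (0 < m (ball x r))%E].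

(* T need not be separable, so [Ball (~` A)] is not automatic for a closed A. *)
Definition concentrated (R : realType) (T : metricType R) (m : set T -> \bar R)
    (A : set T) :=
  Ball (~` A) /\ m (~` A) = 0%E.

Section approximation.
Context {R : realType}.

Definition dist_to (T : metricType R) (A : set T) (x : T) : \bar R :=
  ereal_inf [set (mdist x a)%:E | a in A].

Definition nbhood (T : metricType R) (A : set T) (r : R) : set T :=
  [set x | (dist_to A x < r%:E)%E].

(* f is total: it is an approximation defined on [ball point rho] together with
   a Borel extension to X. *)
Definition approximation (X Y : ppolishType R) (rho e : R) (f : X -> Y) :=
  [/\ 0 < e < rho,
      measurable_fun [set: borel X] (f : borel X -> borel Y),
      f point = point,
      forall x y, ball point rho x -> ball point rho y ->
        `|mdist x y - mdist (f x) (f y)| <= e &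
      ball point (rho - e) `<=` nbhood (f @` ball point rho) e].

Definition quasi_inverse (X Y : ppolishType R) (rho e : R)
    (f : X -> Y) (g : Y -> X) :=
  [/\ approximation (rho - e) (3 * e) g,
      forall x, ball point (rho - 4 * e) x -> mdist x (g (f x)) < 3 * e &
      forall y, ball point (rho - e) y -> mdist y (f (g y)) < 3 * e].

Definition Cbbs (T : ppolishType R) : set (T -> R) :=
  [set h | [/\ continuous h,
               exists M, forall x, `|h x| <= M &
               exists r, closure [set x | h x != 0] `<=` ball point r]].

(* An approximation is a map on [ball point (rho i)], its values elsewhere
   coming from an arbitrary Borel extension.  Hence the push-forward is that of
   the measure restricted to this ball: integrating over all of X_i, mass
   escaping to infinity could be brought back by the extension. *)
Definition pmGH_by (X : nat -> pmmSpace R) (Y : pmmSpace R)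
    (rho eps : nat -> R) (psi : forall i, X i -> Y) :=
  [/\ nondecreasing_seq rho /\ rho i @[i --> \oo] --> +oo,
      nonincreasing_seq eps /\ eps i @[i --> \oo] --> 0,
      forall i, approximation (rho i) (eps i) (psi i) &
      forall h, @Cbbs Y h ->
        (\int['m_(X i)]_(x in ball point (rho i)) (h (psi i x))%:E)%E
          @[i --> \oo] --> (\int['m_Y]_x (h x)%:E)%E].

End approximation.

Definition non_principal (omega : set_system nat) :=
  forall n, omega <> principal_filter n.

Section ultrafilter_facts.
Context {R : realType} (omega : set_system nat) {UO : UltraFilter omega}.

Lemma ultra_ecvg (f : nat -> \bar R) : cvg (f @ omega).
Proof.
apply/cvg_ex => /=.
pose S := [set x | omega [set i | (x <= f i)%E]].
have upS (x : \bar R) : (ereal_sup S < x)%E -> omega [set i | (f i < x)%E].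
  move=> lx; have [|] := in_ultra_setVsetC [set i | (x <= f i)%E] UO.
    by move=> /(@ereal_sup_ubound _ S); rewrite leNgt lx.
  by apply: filterS => i /= /negP; rewrite -ltNge.
have loS (x : \bar R) : (x < ereal_sup S)%E -> omega [set i | (x < f i)%E].
  move=> /ereal_sup_gt[y Sy xy]; apply: filterS Sy => i /=.
  exact: lt_le_trans.
exists (ereal_sup S); move: upS loS; case: (ereal_sup S) => [l||] up lo A /=.
- move=> [e /= e0 leA].
  change (omega (f @^-1` A)).
  have := filterI (up (l + e)%:E _) (lo (l - e)%:E _).
  rewrite !lte_fin ltrDl ltrBlDr ltrDl => /(_ _ e0 e0).
  apply: filterS => i /= [] ; rewrite /preimage/=.
  case: (f i) => [r||]//=; rewrite !lte_fin => r1 r2.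
  apply: leA => /=; rewrite ltr_norml; apply/andP; split; lra.
- by move=> [M [_ MA]]; apply: filterS (lo M%:E (ltry _)) => i; exact: MA.
- by move=> [M [_ MA]]; apply: filterS (up M%:E (ltNyr _)) => i; exact: MA.
Qed.

End ultrafilter_facts.

Section ultralimit.
Context {R : realType} (omega : set_system nat) {UO : UltraFilter omega}.
Variable X : nat -> pmmSpace R.

(* A family indexed by some S in omega takes the value None outside of S. *)
Record family := Family {
  family_fun :> forall i, option (X i) ;
  family_dom : omega [set i | family_fun i] }.

HB.instance Definition _ := gen_eqMixin family.
HB.instance Definition _ := gen_choiceMixin family.

Definition total_family (x : forall i, X i) : family :=
  @Family (fun i => Some (x i)) (filterS (fun _ _ => isT) filterT).

Definition base_family : family := total_family (fun=> point).

Definition ae_eq (x y : family) := `[< \forall i \near omega, x i = y i >].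

Fact ae_eq_refl : reflexive ae_eq.
Proof. by move=> x; apply/asboolP; near=> i. Unshelve. all: by end_near. Qed.

Fact ae_eq_sym : symmetric ae_eq.
Proof.
by move=> x y; apply/idP/idP => /asboolP xy; apply/asboolP;
  apply: filterS xy => i ->.
Qed.

Fact ae_eq_trans : transitive ae_eq.
Proof.
move=> y x z /asboolP xy /asboolP yz; apply/asboolP.
by apply: filterS2 xy yz => i -> ->.
Qed.

Canonical ae_equiv := EquivRel ae_eq ae_eq_refl ae_eq_sym ae_eq_trans.

Definition Xbar := {eq_quot ae_equiv}.
HB.instance Definition _ := Choice.on Xbar.
HB.instance Definition _ := EqQuotient.on Xbar.

Definition family_val (x : family) i : X i := odflt point (x i).

(* The values outside of the domains of the families are irrelevant. *)
Definition family_dist (x y : family) : \bar R :=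
  lim ((mdist (family_val x i) (family_val y i))%:E @[i --> omega]).

Definition dbar (u v : Xbar) : \bar R := family_dist (repr u) (repr v).

Lemma family_dist_cvg (x y : family) :
  (mdist (family_val x i) (family_val y i))%:E @[i --> omega]
    --> family_dist x y.
Proof. exact: ultra_ecvg. Qed.

Lemma eq_family_dist (x x' y y' : family) :
  (\forall i \near omega, x i = x' i) -> (\forall i \near omega, y i = y' i) ->
  family_dist x y = family_dist x' y'.
Proof.
move=> xx' yy'; apply: cvg_lim => //.
apply: cvg_trans (@family_dist_cvg x' y'); apply: near_eq_cvg.
by apply: filterS2 xx' yy' => i xi yi; rewrite /family_val xi yi.
Qed.

Lemma repr_family (x : family) :
  \forall i \near omega, (repr (\pi_Xbar x) : family) i = x i.
Proof. exact/asboolP/(eqmodP ae_equiv)/(reprK (\pi_{eq_quot ae_equiv} x)). Qed.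

Lemma dbarE (x y : family) : dbar (\pi x) (\pi y) = family_dist x y.
Proof. by apply: eq_family_dist; exact: repr_family. Qed.

Lemma dbar_ge0 u v : (0 <= dbar u v)%E.
Proof.
apply: lime_ge; first exact: ultra_ecvg.
by near=> i; rewrite lee_fin mdist_ge0.
Unshelve. all: by end_near. Qed.

Lemma dbarxx u : dbar u u = 0%E.
Proof.
apply: cvg_lim => //; apply: cvg_near_cst.
by near=> i; rewrite mdistxx.
Unshelve. all: by end_near. Qed.

Lemma dbar_sym u v : dbar u v = dbar v u.
Proof.
by rewrite /dbar /family_dist; under eq_fun do rewrite metric_sym.
Qed.

Lemma dbar_triangle v u w : (dbar u w <= dbar u v + dbar v w)%E.
Proof.
rewrite /dbar /family_dist -limeD; [|exact: ultra_ecvg|exact: ultra_ecvg|].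
  apply: lee_lim; [exact: ultra_ecvg|exact: ultra_ecvg|].
  by near=> i; rewrite -EFinD lee_fin metric_triangle.
by apply: ge0_adde_def; rewrite inE; exact: dbar_ge0.
Unshelve. all: by end_near. Qed.

Definition Obar : set Xbar := [set u | (dbar u (\pi base_family) < +oo)%E].

Lemma dbar_fin (u v : Obar) : dbar (val u) (val v) \is a fin_num.
Proof.
rewrite ge0_fin_numE ?dbar_ge0//.
apply: le_lt_trans (dbar_triangle (\pi base_family) _ _) _.
have [Ou Ov] := (set_valP u, set_valP v).
by apply: lte_add_pinfty; [exact: Ou|rewrite dbar_sym; exact: Ov].
Qed.

Definition dnull (u v : Obar) := dbar (val u) (val v) == 0%E.

Fact dnull_refl : reflexive dnull.
Proof. by move=> u; rewrite /dnull dbarxx. Qed.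

Fact dnull_sym : symmetric dnull.
Proof. by move=> u v; rewrite /dnull dbar_sym. Qed.

Fact dnull_trans : transitive dnull.
Proof.
move=> v u w /eqP uv /eqP vw; rewrite /dnull eq_le dbar_ge0 andbT.
by apply: le_trans (dbar_triangle (val v) _ _) _; rewrite uv vw adde0.
Qed.

Canonical dnull_equiv := EquivRel dnull dnull_refl dnull_sym dnull_trans.

Definition ultralimit := {eq_quot dnull_equiv}.
HB.instance Definition _ := Choice.on ultralimit.
HB.instance Definition _ := EqQuotient.on ultralimit.

Definition ultralimit_dist (a b : ultralimit) : R :=
  fine (dbar (val (repr a)) (val (repr b))).

Lemma ultralimit_distE (u v : Obar) :
  ultralimit_dist (\pi u) (\pi v) = fine (dbar (val u) (val v)).
Proof.
have pi0 (w : Obar) : dbar (val (repr (\pi_ultralimit w))) (val w) = 0%E.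
  exact/eqP/(eqmodP dnull_equiv)/(reprK (\pi_{eq_quot dnull_equiv} w)).
rewrite /ultralimit_dist; congr fine; apply/eqP; rewrite eq_le.
set u' := repr _; set v' := repr _.
have le a b c d : dbar a c = 0%E -> dbar b d = 0%E -> (dbar a b <= dbar c d)%E.
  move=> ac bd; apply: le_trans (dbar_triangle c _ _) _; rewrite ac add0e.
  by apply: le_trans (dbar_triangle d _ _) _; rewrite (dbar_sym d) bd adde0.
by rewrite !le// ?pi0// dbar_sym pi0.
Qed.

Fact ultralimit_distxx a : ultralimit_dist a a = 0.
Proof. by rewrite /ultralimit_dist dbarxx. Qed.

Fact ultralimit_dist_eq0 a b : ultralimit_dist a b = 0 -> a = b.
Proof.
move=> ab0; rewrite -[a]reprK -[b]reprK.
apply/(eqmodP dnull_equiv) => /=; by rewrite /dnull -[dbar _ _]fineK ?dbar_fin// -/(ultralimit_dist a b) ab0.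
Qed.

Fact ultralimit_dist_sym a b : ultralimit_dist a b = ultralimit_dist b a.
Proof. by rewrite /ultralimit_dist dbar_sym. Qed.

Fact ultralimit_dist_triangle b a c :
  ultralimit_dist a c <= ultralimit_dist a b + ultralimit_dist b c.
Proof.
rewrite /ultralimit_dist -fineD ?dbar_fin// fine_le ?fin_numD ?dbar_fin//.
exact: dbar_triangle.
Qed.

HB.instance Definition _ := isMetric.Build R ultralimit ultralimit_distxx
  ultralimit_dist_eq0 ultralimit_dist_sym ultralimit_dist_triangle.

Lemma base_Obar : \pi base_family \in Obar.
Proof. by rewrite inE /Obar/= dbarxx ltry. Qed.

HB.instance Definition _ := isPointed.Build ultralimit
  (\pi_ultralimit (SigSub base_Obar)).

Definition Pi_family (A : forall i, set (X i)) : set Xbar :=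
  [set \pi_Xbar x | x in [set x : family |
    \forall i \near omega, exists2 a, x i = Some a & A i a]].

Definition PiO (A : forall i, set (X i)) : set Obar :=
  [set u | Pi_family A (val u)].

(* Families A_i indexed by some S in omega; the sets A_i with i outside of S
   are irrelevant. *)
Definition ae_Ball (A : forall i, set (X i)) :=
  \forall i \near omega, Ball (A i).

Definition AO : set (set Obar) := [set PiO A | A in ae_Ball].

Definition premeasure (A : forall i, set (X i)) : \bar R :=
  lim (lim ('m_(X i) (A i `&` ball point r) @[i --> omega]) @[r --> +oo%R]).

(* [xget] picks some A with PiO A = U; two choices agree on every ball for
   omega-a.e. i, hence have the same premeasure. *)
Definition mbarO (U : set Obar) : \bar R :=
  premeasure (xget (fun=> set0) [set A | ae_Ball A /\ PiO A = U]).

Definition null (N : set Obar) :=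
  forall e : R, 0 < e -> exists U, [/\ AO U, N `<=` U & (mbarO U < e%:E)%E].

Definition approximant (A : set Obar) (r : R) : set (set Obar) :=
  [set U | AO U /\
    null ((A `&` PiO (fun i => ball (point : X i) r)) `+` U)].

Definition Bbar : set (set Obar) :=
  [set A | forall r : R, 0 < r -> approximant A r !=set0].

(* Meaningful on Bbar only; two approximants differ by a null set, so the value
   is again independent of the choice. *)
Definition mbar (A : set Obar) : \bar R :=
  lim (mbarO (xget set0 (approximant A r)) @[r --> +oo%R]).

Definition ball_type := g_sigma_algebraType (@balls R ultralimit).
HB.instance Definition _ := Measurable.on ball_type.

Definition m_omega (A : set ultralimit) : \bar R :=
  mbar (\pi_ultralimit @^-1` A).

End ultralimit.

Arguments Xbar {R} omega {UO} X.
Arguments Obar {R} omega {UO} X.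
Arguments ultralimit {R} omega {UO} X.
Arguments ball_type {R} omega {UO} X.
Arguments m_omega {R} omega {UO} X A.

Lemma non_principal_cofinite (omega : set_system nat) {UO : UltraFilter omega} :
  non_principal omega -> \oo `<=` omega.
Proof.
move=> np; have nP n : omega (~` [set n]).
  have [omn|//] := in_ultra_setVsetC [set n] UO; exfalso; apply: (np n).
  apply/esym/max_filter; first exact: principal_filter_proper.
  move=> A omA; have [k [/= -> An]] := filter_ex (filterI omn omA).
  exact/principal_filterP.
have geN N : omega [set n | (N <= n)%N].
  elim: N => [|N IH]; first by apply: filterS filterT.
  apply: filterS2 IH (nP N) => n /= Nn /eqP nN.
  by rewrite ltn_neqAle eq_sym nN.
by move=> A [N _ NA]; apply: filterS (geN N) => n; exact: NA.
Qed.

Section phi_infinity.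
Context {R : realType} (omega : set_system nat) {UO : UltraFilter omega}.
Hypothesis np : non_principal omega.
Variables (X : nat -> pmmSpace R) (Y : pmmSpace R) (rho eps : nat -> R).
Variables (psi : forall i, X i -> Y) (phi : forall i, Y -> X i).
Arguments psi : clear implicits.
Arguments phi : clear implicits.
Hypothesis psiP : pmGH_by rho eps psi.
Hypothesis phiP : forall i, 4 * eps i < rho i ->
  quasi_inverse (rho i) (eps i) (psi i) (phi i).

Let near_rho (a : R) : \forall i \near omega, a < rho i.
Proof.
have [[_ rhoy] _ _ _] := psiP; apply: (non_principal_cofinite np).
by move/cvgryPgt : rhoy; apply.
Qed.

Let near_eps (e : R) : 0 < e -> \forall i \near omega, 0 < eps i < e.
Proof.
move=> e0; have [_ [_ eps0] psia _] := psiP.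
apply: (non_principal_cofinite np).
move/cvgr0Pnorm_lt : eps0 => /(_ _ e0); apply: filterS => i /=.
by have [/andP[ei0 _] _ _ _ _] := psia i; rewrite gtr0_norm// ei0.
Qed.

Fact quasi_inverse_dom : \forall i \near omega, 4 * eps i < rho i.
Proof.
by apply: filterS2 (near_rho 4) (near_eps ltr01) => i rhoi /andP[_ epsi]; lra.
Qed.

Fact phi_family_dom (y : Y) : omega [set i |
  isSome (if 4 * eps i < rho i then Some (phi i y) else None)].
Proof. by apply: filterS quasi_inverse_dom => i /= ->. Qed.

(* The family (phi_i(y)), indexed by the i with 4 * eps i < rho i. *)
Definition phi_family (y : Y) : family omega X := Family (phi_family_dom y).

Lemma phi_family_dist (x y : Y) :
  family_dist (phi_family x) (phi_family y) = (mdist x y)%:E.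
Proof.
apply: cvg_lim => //; apply: cvg_EFin; first exact: nearW.
apply/cvgrPdist_le => e e0.
have e30 : 0 < Num.min 1 (e / 3) by rewrite lt_min ltr01 divr_gt0.
near=> i; rewrite /family_val /=.
have dom : 4 * eps i < rho i by near: i; exact: quasi_inverse_dom.
have /andP[epsi0] : 0 < eps i < Num.min 1 (e / 3).
  by near: i; exact: near_eps.
rewrite lt_min => /andP[epsi1 epsie]; rewrite dom /=.
have [[_ _ _ iso _] _ _] := phiP dom.
apply: le_trans (iso x y _ _) _; last by lra.
- rewrite ballEmdist/=; have : mdist point x + 1 < rho i by near: i; exact: near_rho.
  lra.
- rewrite ballEmdist/=; have : mdist point y + 1 < rho i by near: i; exact: near_rho.
  lra.
Unshelve. all: by end_near. Qed.

Fact phi_family_Obar (y : Y) :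
  \pi_(Xbar omega X) (phi_family y) \in Obar omega X.
Proof.
rewrite inE /Obar/= dbarE.
rewrite (@eq_family_dist _ _ _ _ _ (phi_family y) _ (phi_family point)).
- by rewrite phi_family_dist ltry.
- by near=> i.
- apply: filterS quasi_inverse_dom => i dom /=; rewrite dom.
  by have [[_ _ -> _ _] _ _] := phiP dom.
Unshelve. all: by end_near. Qed.

Definition phi_infty (y : Y) : ultralimit omega X :=
  \pi_(ultralimit omega X) (SigSub (phi_family_Obar y)).

Lemma phi_infty_isometry (x y : Y) :
  mdist (phi_infty x) (phi_infty y) = mdist x y.
Proof.
by rewrite [LHS]ultralimit_distE /= dbarE phi_family_dist.
Qed.

Lemma measurable_phi_infty :
  measurable_fun setT (phi_infty : borel Y -> ball_type omega X).
Proof.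
apply: (@measurability _ _ (borel Y) (ball_type omega X) setT phi_infty
  (@balls R (ultralimit omega X))) => //.
move=> _ [_ [a [r ->]] <-]; rewrite setTI.
apply: sub_sigma_algebra; rewrite openE => y /=.
rewrite ballEmdist /= => ar; apply/nbhs_ballP.
exists (r - mdist a (phi_infty y)) => /=; first by rewrite subr_gt0.
move=> z; rewrite !ballEmdist /= => yz; rewrite /interior/=.
have := metric_triangle a (phi_infty y) (phi_infty z).
rewrite phi_infty_isometry; lra.
Qed.

End phi_infinity.

(* Main.v *)
Require Import Defs.
From mathcomp Require Import all_boot all_order all_algebra generic_quotient.
From mathcomp Require Import all_classical all_reals all_analysis.
From mathcomp Require Import measurable_realfun lra.

(* Only the identity of measures needs work: phi_oo is an isometry of a complete
   separable space onto a closed set, so it carries the support of m_oo to that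
   of m_omega, and m_oo does not charge the complement of its support.

   Let A be a set of Ball(X_omega), B its preimage in X_oo and r > 0.  Fix
   compact sets K of B and L of the complement of B which exhaust B(p_oo, r + 1)
   up to a small mass (m_oo is tight on balls).  For delta_i -> 0, the points
   x of X_i with psi_i(x) at distance less than delta_i from K (resp. L) form an
   internal set V (resp. W), and by compactness each element of V (resp. W)
   represents phi_oo(k) for some k in K (resp. L); hence V is inside and W is
   outside pi^-1(A).  If delta_i -> 0 slowly enough, weak convergence against
   continuous cut-offs bounds the masses of V and W, so that V and W together
   exhaust the balls B(p_i, r) up to a small mass.  A diagonal sequence of such
   sets V approximates pi^-1(A) up to a null set, and the mass of any
   approximant lies between m_oo(B inter B(p_oo, r - 1)) and m_oo(B). *)

Set Implicit Arguments.
Unset Strict Implicit.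
Unset Printing Implicit Defensive.

Import Order.TTheory GRing.Theory Num.Theory.
Import numFieldNormedType.Exports.

Local Open Scope classical_set_scope.
Local Open Scope ring_scope.

(** * Neighbourhoods and cut-off functions in metric spaces *)

Section metric.
Context {R : realType}.

Lemma lipschitz_continuous (T : metricType R) (f : T -> R) (k : R) :
  (forall x y, `|f x - f y| <= k * mdist x y) -> continuous f.
Proof.
move=> fk x; apply/cvgrPdist_lt => e e0.
(* The constant [|k| + 1] bounds [k] and can be divided by even when [k] is 0. *)
have k0 : 0 < `|k| + 1 by rewrite ltr_wpDl.
near=> y; apply: le_lt_trans (fk x y) _.
have xy : mdist x y < e / (`|k| + 1).
  near: y; apply/nbhs_ballP; exists (e / (`|k| + 1)) => /=; first exact: divr_gt0.
  by move=> y; rewrite ballEmdist.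
apply: le_lt_trans (_ : (`|k| + 1) * mdist x y < e); last first.
  by rewrite mulrC -ltr_pdivlMr.
by apply: ler_wpM2r; [exact: mdist_ge0|have := ler_norm k; lra].
Unshelve. all: by end_near. Qed.

Lemma mdist_lipschitz (T : metricType R) (a x y : T) :
  `|mdist a x - mdist a y| <= mdist x y.
Proof.
have := metric_triangle a x y; have := metric_triangle a y x.
by rewrite (metric_sym y x) ler_norml => ? ?; apply/andP; split; lra.
Qed.

Lemma mdist_continuous (T : metricType R) (a : T) : continuous (mdist a).
Proof.
by apply: (@lipschitz_continuous _ _ 1) => x y; rewrite mul1r; exact: mdist_lipschitz.
Qed.

Lemma mdist_le_closed (T : metricType R) (a : T) (r : R) :
  closed [set x | mdist a x <= r].
Proof.
apply: (@closed_comp _ _ (mdist a) [set t | t <= r]); last exact: closed_le.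
by move=> x _; exact: mdist_continuous.
Qed.

Lemma ball_subset_mdist (T : metricType R) (x y : T) (r s : R) :
  mdist x y + r <= s -> ball y r `<=` ball x s.
Proof.
move=> xy z; rewrite !ballEmdist /= => yz; have := metric_triangle x y z; lra.
Qed.

Lemma ball_is_open (T : metricType R) (a : T) (r : R) : open (ball a r).
Proof.
rewrite openE => y; rewrite ballEmdist /= => ay; apply/nbhs_ballP.
exists (r - mdist a y) => /=; first by rewrite subr_gt0.
by move=> z; rewrite !ballEmdist /=; have := metric_triangle a y z; lra.
Qed.

(** The set of points at distance less than [d] from [C], written as a union of balls so that it is
    visibly open; it is empty when [C] is. *)
Definition nbr (T : metricType R) (C : set T) (d : R) : set T :=
  \bigcup_(c in C) ball c d.

Lemma nbr_open (T : metricType R) (C : set T) (d : R) : open (nbr C d).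
Proof. by apply: bigcup_open => c _; exact: ball_is_open. Qed.

Lemma nbr_le (T : metricType R) (C : set T) (d e : R) :
  d <= e -> nbr C d `<=` nbr C e.
Proof. by move=> de x [c Cc cx]; exists c => //; exact: le_ball cx. Qed.

Lemma nbrU (T : metricType R) (C D : set T) (d : R) :
  nbr (C `|` D) d = nbr C d `|` nbr D d.
Proof. exact: bigcup_setU. Qed.

(* The function min(1, dist(x,C)/d), also when C is empty. *)
Definition tent (T : metricType R) (C : set T) (d : R) (x : T) : R :=
  inf ([set 1] `|` [set mdist x c / d | c in C]).

Section tent.
Variables (T : metricType R) (C : set T) (d : R).
Hypothesis d0 : 0 < d.

Let lb0 x : lbound ([set 1] `|` [set mdist x c / d | c in C]) 0.
Proof.
move=> _ [->|[c _ <-]]; first exact: ler01.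
by rewrite divr_ge0 ?mdist_ge0// ltW.
Qed.

Let hlb x : has_lbound ([set 1] `|` [set mdist x c / d | c in C]).
Proof. by exists 0; exact: lb0. Qed.

Let ne x : [set 1] `|` [set mdist x c / d | c in C] !=set0.
Proof. by exists 1; left. Qed.

Lemma tent_ge0 x : 0 <= tent C d x.
Proof. by apply: lb_le_inf; [exact: ne|exact: lb0]. Qed.

Lemma tent_le1 x : tent C d x <= 1.
Proof. by apply: ge_inf; [exact: hlb|left]. Qed.

Lemma tent_eq0 x : C x -> tent C d x = 0.
Proof.
move=> Cx; apply/eqP; rewrite eq_le tent_ge0 andbT.
by apply: ge_inf; [exact: hlb|right; exists x => //; rewrite mdistxx mul0r].
Qed.

Lemma tent_eq1 x : ~ nbr C d x -> tent C d x = 1.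
Proof.
move=> Cx; apply/eqP; rewrite eq_le tent_le1 /=.
apply: lb_le_inf; first exact: ne.
move=> _ [->//|[c Cc <-]]; rewrite ler_pdivlMr// mul1r leNgt.
by apply/negP => cd; apply: Cx; exists c => //; rewrite ballEmdist /= metric_sym.
Qed.

Lemma tent_continuous : continuous (tent C d).
Proof.
apply: (@lipschitz_continuous _ _ d^-1) => x y.
have le x' y' : tent C d x' <= tent C d y' + d^-1 * mdist x' y'.
  rewrite -lerBlDr; apply: lb_le_inf; first exact: ne.
  have xy0 : 0 <= d^-1 * mdist x' y' by rewrite mulr_ge0 ?mdist_ge0// invr_ge0 ltW.
  move=> _ [->|[c Cc <-]]; first by have := tent_le1 x'; lra.
  have : tent C d x' <= mdist x' c / d.
    by apply: ge_inf; [exact: hlb|right; exists c].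
  move/le_trans; rewrite lerBlDr; apply.
  rewrite [d^-1 * _]mulrC -mulrDl ler_pM2r ?invr_gt0//.
  by rewrite addrC; exact: metric_triangle.
have := le x y; have := le y x; rewrite (metric_sym y x) ler_norml => ? ?.
by apply/andP; split; lra.
Qed.

End tent.

End metric.

Lemma exists_natSinv_lt (R : realType) (e : R) : 0 < e -> exists k : nat, k.+1%:R^-1 < e.
Proof.
by move=> e0; have /ltr_add_invr[k] := e0; rewrite add0r; exists k.
Qed.

(** * Balls and Borel sets in Polish spaces *)

Section polish.
Context {R : realType} (T : ppolishType R).

Lemma dense_sequence :
  exists s : nat -> T, forall x (e : R), 0 < e -> exists n, ball (s n) e x.
Proof.
have [D cD dD] := @separable_dense _ T.
have [D0|[f]] := pfcard_geP cD.
  have := dD setT (ex_intro _ point I) openT; by rewrite D0 setI0 => -[].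
exists f => x e e0.
have [|y [xy Dy]] := dD (ball x e) _ (ball_is_open _ _).
  by exists x; exact: ballxx.
have [n _ ny] : exists2 n, [set: nat] n & f n = y.
  by have := @surj _ _ _ _ f; apply.
by exists n; rewrite ny; exact/ball_sym.
Qed.

Lemma open_bigcup_balls (A : set T) : open A ->
  exists (s : nat -> T) (F : nat -> nat -> set T),
    A = \bigcup_n \bigcup_k F n k /\
    forall n k, F n k = set0 \/ F n k = ball (s n) (k.+1%:R^-1 : R).
Proof.
move=> oA; have [s sP] := dense_sequence.
pose F n k := if `[< ball (s n) (k.+1%:R^-1 : R) `<=` A >]
  then ball (s n) (k.+1%:R^-1 : R) else set0.
exists s, F; split; last by move=> n k; rewrite /F; case: asboolP; [right|left].
apply/seteqP; split; last first.
  by move=> x [n _ [k _]]; rewrite /F; case: asboolP => // FA /FA.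
move=> x Ax; have := open_nbhs_nbhs (conj oA Ax).
move=> /nbhs_ballP[e /= e0 eA].
(* With radius below [e / 2], a ball around a dense point that contains [x] stays inside
   [ball x e]. *)
have [k ke] : exists k : nat, k.+1%:R^-1 < e / 2.
  by apply: exists_natSinv_lt; rewrite divr_gt0.
have k0 : 0 < k.+1%:R^-1 :> R by rewrite invr_gt0.
have [n nx] := sP x _ k0.
exists n => //; exists k => //; rewrite /F; case: asboolP => // /(_ _)[].
apply: subset_trans eA; apply: ball_subset_mdist.
move: nx; rewrite ballEmdist /= metric_sym; move: ke; set a := _^-1; lra.
Qed.

Lemma open_Ball (A : set T) : open A -> Ball A.
Proof.
move=> /open_bigcup_balls[s [F [-> Fk]]].
pose T' := g_sigma_algebraType (@balls R T).
apply: (@bigcupT_measurable _ T') => n; apply: (@bigcupT_measurable _ T') => k.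
have [->|->] := Fk n k; first exact: (@measurable0 _ T').
by apply: sub_sigma_algebra; exists (s n), k.+1%:R^-1.
Qed.

Lemma open_borel (A : set T) : open A -> measurable (A : set (borel T)).
Proof. exact: sub_sigma_algebra. Qed.

Lemma closed_borel (A : set T) : closed A -> measurable (A : set (borel T)).
Proof.
by move=> /closed_openC/open_borel/measurableC; rewrite setCK.
Qed.

(** By separability every open set is a countable union of balls. This is what lets the measures,
    defined on [borel], be applied to internal sets, whose members lie in [Ball]. *)
Lemma Ball_borel (A : set T) : Ball A <-> measurable (A : set (borel T)).
Proof.
split.
  suff : @Ball R T `<=` @measurable _ (borel T) by exact.
  apply: smallest_sub; first exact: smallest_sigma_algebra.
  by move=> _ [x [r ->]]; apply: open_borel; exact: ball_is_open.
suff : @measurable _ (borel T) `<=` @Ball R T by exact.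
apply: smallest_sub; first exact: smallest_sigma_algebra.
exact: open_Ball.
Qed.

End polish.

(** * Strict bounds along filters, and finite unions in ultrafilters *)

Lemma cvge_near_lt (R : realType) (I : Type) (F : set_system I) {FF : Filter F}
    (f : I -> \bar R) (l c : \bar R) :
  f @ F --> l -> (l < c)%E -> \forall i \near F, (f i < c)%E.
Proof.
move=> fl lc; apply: (fl [set y | (y < c)%E]); apply: open_nbhs_nbhs; split => //.
exact: open_ereal_lt_ereal.
Qed.

Lemma cvge_near_gt (R : realType) (I : Type) (F : set_system I) {FF : Filter F}
    (f : I -> \bar R) (l c : \bar R) :
  f @ F --> l -> (c < l)%E -> \forall i \near F, (c < f i)%E.
Proof.
move=> fl lc; apply: (fl [set y | (c < y)%E]); apply: open_nbhs_nbhs; split => //.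
exact: open_ereal_gt_ereal.
Qed.

(** Total boundedness is used through this fact: an ultrafilter on a finite union of small balls
    selects one of them. *)
Lemma ultra_bigsetU (T : Type) (F : set_system T) (B : nat -> set T) (N : nat) :
  UltraFilter F -> F (\big[setU/set0]_(n < N) B n) -> exists n, F (B n).
Proof.
move=> UF; elim: N => [|N IH].
  by rewrite big_ord0 => /filter_ex[].
rewrite big_ord_recr /= => FU.
have [?|FN] := in_ultra_setVsetC (B N) UF; first by exists N.
by apply: IH; apply: filterS2 FU FN => x [].
Qed.

(** * Inner regularity of finite Borel measures on Polish spaces *)

Section regularity.
Context {R : realType} (T : ppolishType R).
Variable mu : {measure set (borel T) -> \bar R}.
Hypothesis mufin : (mu setT < +oo)%E.
Local Open Scope ereal_scope.

Let mu_lty (A : set (borel T)) : measurable A -> mu A < +oo.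
Proof.
by move=> mA; apply: le_lt_trans mufin; apply: le_measure; rewrite ?inE.
Qed.

Lemma nonincreasing_measure_small (F : nat -> set (borel T)) (e : R) :
  (forall n, measurable (F n)) -> {homo F : m n / (m <= n)%N >-> n `<=` m} ->
  \bigcap_n F n = set0 -> (0 < e)%R -> exists n, mu (F n) <= e%:E.
Proof.
move=> mF ndF F0 e0.
have := @nonincreasing_cvg_mu _ _ _ mu F (mu_lty (mF 0%N)) mF.
rewrite F0 measure0 => /(_ (@measurable0 _ _)) cvF.
have {}cvF : mu \o F @ \oo --> 0.
  by apply: cvF => m n mn; apply/subsetPset; exact: ndF.
have [|n _ /(_ n (leqnn n))/ltW] := cvge_near_lt cvF (_ : 0 < e%:E).
  by rewrite lte_fin.
by exists n.
Qed.

Lemma measure_bigcup_small (F : nat -> set (borel T)) (e : R) :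
  (0 < e)%R -> (forall n, measurable (F n)) ->
  (forall n, mu (F n) <= (e / (2 ^ n.+1)%:R)%:E) -> mu (\bigcup_n F n) <= e%:E.
Proof.
move=> e0 mF Fe; apply: (le_trans _ (epsilon_trick0 xpredT (ltW e0))).
apply: (@le_trans _ _ (\sum_(n <oo) mu (F n))); last exact: lee_nneseries.
apply: measure_sigma_subadditive => //; exact: bigcupT_measurable.
Qed.

Let dyadic_gt0 (e : R) n : (0 < e -> 0 < e / (2 ^ n.+1)%:R)%R.
Proof. by move=> e0; rewrite divr_gt0// ltr0n expn_gt0. Qed.

(** Ulam's theorem. For each [k], finitely many closed balls of radius [1/(k+1)] carry all the mass
    but [e/2^(k+1)]; the intersection over [k] of these finite unions is closed and totally bounded,
    hence compact by completeness. *)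
Lemma tight (e : R) : (0 < e)%R -> exists2 K : set T, compact K & mu (~` K) <= e%:E.
Proof.
move=> e0; have [s sP] := dense_sequence T.
pose B k n : set T := [set x | (mdist (s n) x <= k.+1%:R^-1)%R].
have cB k n : closed (B k n) by exact: mdist_le_closed.
pose C k N : set T := \big[setU/set0]_(n < N) B k n.
have cC k N : closed (C k N) by apply: closed_bigsetU => n _; exact: cB.
have mC k N : measurable (~` C k N : set (borel T)).
  by apply: open_borel; exact: closed_openC.
have /choice[N NP] k : exists N, mu (~` C k N) <= (e / (2 ^ k.+1)%:R)%:E.
  apply: nonincreasing_measure_small (dyadic_gt0 _ e0) => //.
  - by move=> m n mn; apply: subsetC; exact: subset_bigsetU.
  - rewrite -setC_bigcup -setCT; congr (~` _); apply/seteqP; split => // x _.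
    have k0 : (0 < k.+1%:R^-1 :> R)%R by rewrite invr_gt0.
    have [n] := sP x _ k0; rewrite ballEmdist /= => nx.
    by exists n.+1 => //; rewrite /C big_ord_recr /=; right; exact: ltW.
exists (\bigcap_k C k (N k)); last first.
  by rewrite setC_bigcap; apply: measure_bigcup_small.
rewrite compact_ultra => F UF FK.
have cK : closed (\bigcap_k C k (N k)) by apply: closed_bigI => k _; exact: cC.
(* An ultrafilter on the intersection contains a ball of each radius [1/(k+1)], so it is Cauchy. *)
have /cauchy_exP/cauchy_cvg cF : cauchy_ex F.
  move=> d d0; have [k kd] := exists_natSinv_lt d0.
  suff [n Fn] : exists n, F (B k n).
    exists (s n); apply: filterS Fn => x.
    by rewrite ballEmdist /B /= => /le_lt_trans; exact.
  have : F (C k (N k)) by apply: filterS FK => x; exact.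
  exact: ultra_bigsetU.
by exists (lim F); split => //; apply: (@closed_cvg _ _ F _ (fun x => x) _ cK FK).
Qed.

(** Measurability is part of the property so that the induction over the generated sigma-algebra has
    it at hand for every set it meets. *)
Definition compact_approximable (B : set (borel T)) := measurable B /\
  forall e : R, (0 < e)%R ->
    exists K : set T, [/\ compact K, K `<=` B & mu (B `\` K) <= e%:E].

Lemma compact_borel (K : set T) : compact K -> measurable (K : set (borel T)).
Proof.
by move=> cK; apply: closed_borel; exact: compact_closed (@metric_hausdorff R T) cK.
Qed.

Lemma closed_approximable (F : set T) : closed F -> compact_approximable F.
Proof.
move=> cF; split; first exact: closed_borel.
move=> e /tight[K cK Ke]; exists (K `&` F).
have cKF := compact_closedI cK cF.
split => //; apply: (le_trans _ Ke); apply: le_measure; rewrite ?inE.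
- by apply: measurableD; [exact: closed_borel|exact: compact_borel].
- by apply: measurableC; exact: compact_borel.
- by move=> x [Fx nKF] Kx; exact: nKF.
Qed.

(** The intersection of the [K n] is compact, and what it misses lies in the union of the [B n]
    minus [K n], of mass at most the sum of [e/2^(n+1)]. *)
Lemma bigcap_approximable (B : nat -> set (borel T)) :
  (forall n, compact_approximable (B n)) -> compact_approximable (\bigcap_n B n).
Proof.
move=> aB; have mB n : measurable (B n) by case: (aB n).
split; first exact: bigcapT_measurable.
move=> e e0.
have /choice[K KP] n : exists K : set T,
    [/\ compact K, K `<=` B n & mu (B n `\` K) <= (e / (2 ^ n.+1)%:R)%:E].
  by have [_] := aB n; apply; exact: dyadic_gt0.
have clK n : closed (K n).
  by apply: (compact_closed (@metric_hausdorff R T)); case: (KP n).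
exists (\bigcap_n K n); split.
- apply: (subclosed_compact _ (B := K 0%N)).
  + by apply: closed_bigI => n _; exact: clK.
  + by case: (KP 0%N).
  + by move=> x; apply.
- by move=> x Kx n _; have [_ KB _] := KP n; exact/KB/Kx.
have mBK n : measurable (B n `\` K n).
  by apply: measurableD => //; exact: closed_borel.
apply: (le_trans _ (@measure_bigcup_small (fun n => B n `\` K n) _ e0 mBK _)); last first.
  by move=> n; case: (KP n).
apply: le_measure; rewrite ?inE.
- apply: measurableD; first exact: bigcapT_measurable.
  by apply: bigcapT_measurable => n; exact: closed_borel.
- exact: bigcupT_measurable.
- move=> x [Bx /existsNP[n /not_implyP[_ nKx]]]; exists n => //.
  by split => //; exact: Bx.
Qed.

(** A countable union of compact sets need not be compact. Half of [e] pays for truncating the union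
    at some [N], the other half for the compact approximations. *)
Lemma bigcup_approximable (B : nat -> set (borel T)) :
  (forall n, compact_approximable (B n)) -> compact_approximable (\bigcup_n B n).
Proof.
move=> aB; have mB n : measurable (B n) by case: (aB n).
split; first exact: bigcupT_measurable.
move=> e e0; have e20 : (0 < e / 2)%R by rewrite divr_gt0.
have /choice[K KP] n : exists K : set T,
    [/\ compact K, K `<=` B n & mu (B n `\` K) <= (e / 2 / (2 ^ n.+1)%:R)%:E].
  by have [_] := aB n; apply; exact: dyadic_gt0.
have mK n : measurable (K n : set (borel T)).
  by apply: compact_borel; case: (KP n).
have mBK n : measurable (B n `\` K n) by exact: measurableD.
have mU N : measurable (\big[setU/set0]_(n < N) B n) by exact: bigsetU_measurable.
have mD N : measurable (\bigcup_n B n `\` \big[setU/set0]_(n < N) B n).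
  by apply: measurableD => //; exact: bigcupT_measurable.
have [||N NP] := nonincreasing_measure_small mD _ _ e20.
- by move=> m n mn; apply: setDS; exact: subset_bigsetU.
- rewrite -subset0 => x Bx; have [[n _ Bnx] _] := Bx 0%N I.
  have [_] := Bx n.+1 I; apply; by rewrite big_ord_recr /=; right.
exists (\big[setU/set0]_(n < N) K n); split.
- by apply: bigsetU_compact => n _; case: (KP n).
- move=> x; rewrite -bigcup_mkord => -[n _ Kx]; exists n => //.
  by have [_ + _] := KP n; apply.
rewrite [e]splitr EFinD.
apply: (le_trans _ (leeD NP (measure_bigcup_small e20 mBK _))); last first.
  by move=> n; case: (KP n).
apply: (le_trans _ (measureU2 _ (mD N) _)); last exact: bigcupT_measurable.
apply: le_measure; rewrite ?inE.
- apply: measurableD; first exact: bigcupT_measurable.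
  exact: bigsetU_measurable.
- by apply: measurableU => //; exact: bigcupT_measurable.
- move=> x [Bx nKx]; have [|] := pselect ((\big[setU/set0]_(n < N) B n) x).
    rewrite -bigcup_mkord => -[n nN Bnx]; right; exists n => //; split => // Kx.
    by apply: nKx; rewrite -bigcup_mkord; exists n.
  by left.
Qed.

(** An open set is the countable union of the closed sets of points at distance at least [1/(n+1)]
    from its complement. *)
Lemma open_approximable (O : set T) : open O -> compact_approximable O.
Proof.
move=> oO.
pose F n : set T := \bigcap_(y in ~` O) [set x | (n.+1%:R^-1 <= mdist y x)%R].
have -> : O = \bigcup_n F n.
  apply/seteqP; split => x.
    move=> Ox; have /nbhs_ballP[d /= d0 dO] := open_nbhs_nbhs (conj oO Ox).
    have [n nd] := exists_natSinv_lt d0; exists n => // y nOy /=.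
    rewrite leNgt; apply/negP => yx; apply: nOy; apply: dO.
    by rewrite ballEmdist /= metric_sym; exact: lt_trans nd.
  move=> [n _ Fx]; apply: contrapT => nOx; have := Fx x nOx.
  by rewrite /= mdistxx leNgt invr_gt0 ltr0Sn.
apply: bigcup_approximable => n; apply: closed_approximable.
apply: closed_bigI => y _.
apply: (@closed_comp _ _ (mdist y) [set t | (n.+1%:R^-1 <= t)%R]); last exact: closed_ge.
by move=> x _; exact: mdist_continuous.
Qed.

(** The sets that are approximable together with their complements form a sigma-algebra containing
    the open sets. *)
Lemma borel_approximable (B : set (borel T)) :
  measurable B -> compact_approximable B.
Proof.
suff /(_ B) : measurable `<=`
    [set B | compact_approximable B /\ compact_approximable (~` B)].
  by move=> h /h[].
apply: smallest_sub; last first.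
  move=> O oO; split; first exact: open_approximable.
  by apply: closed_approximable; exact: open_closedC.
split => [|A [aA aCA]|A aA] /=.
- by rewrite setC0; split; apply: closed_approximable; [exact: closed0|exact: closedT].
- by rewrite setTD setCK.
- split; first by apply: bigcup_approximable => n; case: (aA n).
  by rewrite setC_bigcup; apply: bigcap_approximable => n; case: (aA n).
Qed.

End regularity.

(** * Internal sets and their approximants *)

Section internal.
Context {R : realType} (omega : set_system nat) {UO : UltraFilter omega}.
Variable X : nat -> pmmSpace R.
Local Open Scope quotient_scope.

(** A chosen representative of the class [u], made total by the value [point] outside its domain. *)
Definition rep (u : Obar omega X) i : X i := family_val (repr (val u)) i.

Lemma PiOE (A : forall i, set (X i)) (u : Obar omega X) :
  PiO A u <-> \forall i \near omega, A i (rep u i).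
Proof.
split.
  move=> [x xA xu].
  have xr : \forall i \near omega, (repr (val u) : Defs.family omega X) i = x i.
    by rewrite -xu; exact: repr_family.
  by apply: filterS2 xA xr => i [a xa Aa] xr; rewrite /rep /family_val xr xa.
move=> uA; exists (repr (val u)); last exact: reprK.
apply: filterS2 uA (family_dom (repr (val u))) => i.
rewrite /rep /family_val /=; case: family_fun => // a Aa _.
by exists a.
Qed.

(** Maximality of the ultrafilter: what fails to hold almost everywhere is false almost
    everywhere. *)
Lemma PiOC (A : forall i, set (X i)) (u : Obar omega X) :
  ~ PiO A u -> \forall i \near omega, ~ A i (rep u i).
Proof.
by move=> nA; have [/PiOE//|] := in_ultra_setVsetC [set i | A i (rep u i)] UO.
Qed.

Lemma rep_bounded (u : Obar omega X) :
  exists s : R, \forall i \near omega, ball point s (rep u i).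
Proof.
have Ou : (dbar (val u) (\pi_(Xbar omega X) (base_family X)) < +oo)%E.
  exact: set_valP u.
set l := dbar _ _ in Ou.
have lf : l \is a fin_num by rewrite ge0_fin_numE// dbar_ge0.
exists (fine l + 1).
have ll : (l < (fine l + 1)%:E)%E by rewrite EFinD fineK// lteDl.
have dl : \forall i \near omega, ((mdist (rep u i)
    (family_val (repr (\pi_(Xbar omega X) (base_family X))) i))%:E < (fine l + 1)%:E)%E.
  exact: cvge_near_lt (@family_dist_cvg _ _ UO X _ _) ll.
apply: filterS2 (repr_family (base_family X)) dl => i bi.
by rewrite lte_fin ballEmdist /= metric_sym /family_val bi.
Qed.

Lemma rep_lift (x : forall i, X i) (s : R) :
  (\forall i \near omega, ball point s (x i)) ->
  exists u : Obar omega X, \forall i \near omega, rep u i = x i.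
Proof.
move=> xs; have Ox : \pi_(Xbar omega X) (total_family x) \in Obar omega X.
  rewrite inE /Obar /= dbarE; apply: le_lt_trans (ltry s).
  apply: lime_le; first exact: ultra_ecvg.
  apply: filterS xs => i; rewrite ballEmdist /= lee_fin metric_sym => /ltW; exact.
exists (SigSub Ox); apply: filterS (repr_family (total_family x)) => i /= xi.
by rewrite /rep /= /family_val xi.
Qed.

Lemma rep_pi_eq (u v : Obar omega X) :
  (forall e : R, 0 < e -> \forall i \near omega, mdist (rep u i) (rep v i) < e) ->
  \pi_(ultralimit omega X) u = \pi_(ultralimit omega X) v.
Proof.
move=> uv; apply/(eqmodP (dnull_equiv X)) => /=.
rewrite /dnull eq_le dbar_ge0 andbT; apply/lee_addgt0Pr => e e0.
rewrite add0e; apply: lime_le; first exact: ultra_ecvg.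
by apply: filterS (uv e e0) => i; rewrite lee_fin => /ltW.
Qed.

(** Transfer of an inclusion from the ultraproduct to almost every factor: otherwise counterexamples
    [x i] exist for almost every [i]. The bound [s] puts their class in [Obar], where it contradicts
    the inclusion. *)
Lemma rep_bounded_sub (A B : forall i, set (X i)) (s : R) :
  (\forall i \near omega, A i `<=` ball point s) -> PiO A `<=` PiO (omega := omega) B ->
  \forall i \near omega, A i `<=` B i.
Proof.
move=> As AB.
have [//|nAB] := in_ultra_setVsetC [set i | A i `<=` B i] UO.
pose x i := xget (point : X i) (A i `\` B i).
have xP i : ~ (A i `<=` B i) -> A i (x i) /\ ~ B i (x i).
  move=> /existsNP[y /not_implyP[Ay nBy]].
  by apply: (@xgetPex _ point (A i `\` B i)); exists y.
have xs : \forall i \near omega, ball point s (x i).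
  by apply: filterS2 As nAB => i Ai /xP[+ _]; exact: Ai.
have [u ux] := rep_lift xs.
have /AB/PiOE uB : PiO A u.
  by apply/PiOE; apply: filterS2 ux nAB => i -> /xP[].
have : omega set0; last by move=> /filter_ex[].
by apply: filterS3 ux uB nAB => i -> Bi /xP[_].
Qed.

Hypothesis np : non_principal omega.

Lemma near_forall_le (P : nat -> nat -> Prop) (n : nat) :
  (forall m, \forall i \near omega, P m i) ->
  \forall i \near omega, forall m, (m <= n)%N -> P m i.
Proof.
move=> Pm; elim: n => [|n IH].
  by apply: filterS (Pm 0%N) => i P0 m; rewrite leqn0 => /eqP ->.
apply: filterS2 IH (Pm n.+1) => i Qi Pi m; rewrite leq_eqVlt => /orP[/eqP -> //|].
by rewrite ltnS; exact: Qi.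
Qed.

(** A form of countable saturation: countably many almost sure properties hold jointly up to an
    index [n_ i] that tends to infinity along [omega]. *)
Lemma near_diagonal (P : nat -> nat -> Prop) :
  (forall n, \forall i \near omega, P n i) ->
  exists n_ : nat -> nat, (forall N, \forall i \near omega, (N <= n_ i)%N) /\
    \forall i \near omega, forall m, (m <= n_ i)%N -> P m i.
Proof.
move=> Pn.
pose Q n i := forall m, (m <= n)%N -> P m i.
have Qn n : \forall i \near omega, Q n i by exact: near_forall_le.
(* Capping at [i] makes the maximum finite; since [omega] is non-principal, [i] itself exceeds any
   [N] almost everywhere. *)
pose n_ i := (\max_(n < i.+1 | `[< Q n i >]) n)%N.
exists n_; split=> [N|].
  have Ni : \forall i \near omega, (N <= i)%N.
    by apply: (non_principal_cofinite np); exists N.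
  apply: filterS2 (Qn N) Ni => i QN Ni.
  exact: (leq_bigmax_cond (Ordinal (Ni : (N < i.+1)%N)) (asboolT QN)).
(* [Q 0 i] ensures that the maximum is attained: an empty maximum would also be 0, but without
   giving [Q]. *)
apply: filterS (Qn 0%N) => i Q0.
have [|n /asboolP Qni ne] :=
    @eq_bigmax_cond _ (fun n : 'I_i.+1 => `[< Q n i >]) (@nat_of_ord _).
  by apply/card_gt0P; exists ord0; apply/asboolP.
by have -> : n_ i = n by exact: ne.
Qed.

Let mi i (A : set (X i)) : \bar R := 'm_(X i) A.
Let B (r : R) i : set (X i) := ball point r.
Arguments B : clear implicits.

Lemma Ball_ball i (r : R) : Ball (B r i).
Proof. by apply: sub_sigma_algebra; exists point, r. Qed.

Lemma BallI i (C D : set (X i)) : Ball C -> Ball D -> Ball (C `&` D).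
Proof. by move=> /Ball_borel mC /Ball_borel mD; apply/Ball_borel/measurableI. Qed.

Lemma BallU i (C D : set (X i)) : Ball C -> Ball D -> Ball (C `|` D).
Proof. by move=> /Ball_borel mC /Ball_borel mD; apply/Ball_borel/measurableU. Qed.

Lemma BallD i (C D : set (X i)) : Ball C -> Ball D -> Ball (C `\` D).
Proof. by move=> /Ball_borel mC /Ball_borel mD; apply/Ball_borel/measurableD. Qed.

Lemma Ball_le i (C D : set (X i)) : Ball C -> Ball D -> C `<=` D -> (mi C <= mi D)%E.
Proof. by move=> /Ball_borel mC /Ball_borel mD CD; apply: le_measure; rewrite ?inE. Qed.

Lemma Ball_leU i (C D E : set (X i)) : Ball C -> Ball D -> Ball E -> C `<=` D `|` E ->
  (mi C <= mi D + mi E)%E.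
Proof.
move=> mC mD mE CDE; apply: (le_trans (Ball_le mC (BallU mD mE) CDE)).
by apply: measureU2; exact/Ball_borel.
Qed.

Definition premeasure_on (A : forall i, set (X i)) (r : R) : \bar R :=
  lim (mi (A i `&` B r i) @[i --> omega]).

Lemma premeasure_on_cvg A r :
  mi (A i `&` B r i) @[i --> omega] --> premeasure_on A r.
Proof. exact: ultra_ecvg. Qed.

Lemma premeasure_on_nd A : ae_Ball omega A -> nondecreasing_fun (premeasure_on A).
Proof.
move=> mA r s rs; apply: lee_lim; [exact: ultra_ecvg|exact: ultra_ecvg|].
apply: filterS mA => i mAi; apply: Ball_le; [by apply: BallI; last exact: Ball_ball..|].
by apply: setIS; exact: le_ball.
Qed.

(** The inner limit is nondecreasing in the radius, so the outer limit exists and is a supremum. *)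
Lemma premeasure_cvg A : ae_Ball omega A ->
  premeasure_on A r @[r --> +oo%R] --> premeasure omega A.
Proof.
move=> mA; apply/cvg_ex; exists (ereal_sup (range (premeasure_on A))).
exact/nondecreasing_cvge/premeasure_on_nd.
Qed.

Lemma premeasure_on_le A r : ae_Ball omega A ->
  (premeasure_on A r <= premeasure omega A)%E.
Proof.
move=> mA; apply: lime_ge.
  by apply/cvg_ex; exists (premeasure omega A); exact: premeasure_cvg.
by near=> s; apply: premeasure_on_nd => //; near: s; exact: nbhs_pinfty_ge.
Unshelve. all: by end_near. Qed.

Lemma premeasure_ge A r c : ae_Ball omega A ->
  (\forall i \near omega, (c <= mi (A i `&` B r i))%E) -> (c <= premeasure omega A)%E.
Proof.
move=> mA cA; apply: le_trans (premeasure_on_le r mA).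
by apply: lime_ge => //; exact: ultra_ecvg.
Qed.

Lemma premeasure_le_on A c : ae_Ball omega A ->
  (forall r, (premeasure_on A r <= c)%E) -> (premeasure omega A <= c)%E.
Proof.
move=> mA cA; apply: lime_le; last exact: nearW.
by apply/cvg_ex; exists (premeasure omega A); exact: premeasure_cvg.
Qed.

Lemma premeasure_le A c : ae_Ball omega A ->
  (forall r, \forall i \near omega, (mi (A i `&` B r i) <= c)%E) ->
  (premeasure omega A <= c)%E.
Proof.
move=> mA cA; apply: premeasure_le_on => // r.
by apply: lime_le; [exact: ultra_ecvg|exact: cA].
Qed.

Lemma premeasure_lt A c : ae_Ball omega A -> (premeasure omega A < c)%E ->
  forall r, \forall i \near omega, (mi (A i `&` B r i) < c)%E.
Proof.
move=> mA Ac r.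
exact: cvge_near_lt (@premeasure_on_cvg A r) (le_lt_trans (premeasure_on_le r mA) Ac).
Qed.

(** On each ball the inclusion transfers to almost every factor. In particular the premeasure
    depends only on the set [PiO A]. *)
Lemma premeasure_mono (A C : forall i, set (X i)) : ae_Ball omega A -> ae_Ball omega C ->
  PiO A `<=` PiO (omega := omega) C -> (premeasure omega A <= premeasure omega C)%E.
Proof.
move=> mA mC AC; apply: premeasure_le_on => // r.
apply: le_trans (premeasure_on_le r mC).
apply: lee_lim; [exact: ultra_ecvg|exact: ultra_ecvg|].
have ACr : \forall i \near omega, A i `&` B r i `<=` C i.
  apply: (@rep_bounded_sub (fun i => A i `&` B r i) C r); first by apply: nearW => i x [].
  by move=> u /PiOE uA; apply: AC; apply/PiOE; apply: filterS uA => i [].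
apply: filterS3 mA mC ACr => i mAi mCi ACi.
apply: Ball_le; [by apply: BallI; last exact: Ball_ball..|].
by move=> x [Ax Bx]; split => //; exact: ACi.
Qed.

Lemma mbarOP (U : set (Obar omega X)) : AO U ->
  exists A, [/\ ae_Ball omega A, PiO A = U & mbarO U = premeasure omega A].
Proof.
move=> [A mA AU].
rewrite /mbarO; case: xgetP => [A' _ [mA' AU']|/(_ A)]; first by exists A'.
by case.
Qed.

(** By monotonicity any internal cover can replace the one picked in [mbarO]; passing to [e / 2]
    restores the strict inequality. *)
Lemma nullP (N : set (Obar omega X)) : null N <-> forall e : R, 0 < e ->
  exists E, [/\ ae_Ball omega E, N `<=` PiO E & (premeasure omega E <= e%:E)%E].
Proof.
split=> nN e e0.
  have [U [AU NU Ue]] := nN e e0; have [E [mE EU UE]] := mbarOP AU.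
  by exists E; rewrite EU -UE ltW.
have [|E [mE NE Ee]] := nN (e / 2); first by rewrite divr_gt0.
exists (PiO E); have AE : AO (PiO (omega := omega) E) by exists E.
split => //; have [E' [mE' EE' ->]] := mbarOP AE.
apply: le_lt_trans (premeasure_mono mE' mE _) _; first by rewrite EE'.
by apply: le_lt_trans Ee _; rewrite lte_fin; lra.
Qed.

Section approximant.
Variables (C : set (Obar omega X)) (r : R).

(** Take inner sets [V n] and outer sets [W n] with error [1/(n+1)], and let [U i] be the union of
    the [V m i] for [m <= n_ i], cut to the ball. If [n_] grows slowly, [U] contains every [V n] on
    the ball and avoids every [W n], so its difference from [C] lies in each error set. *)
Lemma approximant_exists :
  (forall e : R, 0 < e -> exists V W, [/\ ae_Ball omega V, ae_Ball omega W,
    PiO V `<=` C, PiO (omega := omega) W `<=` ~` C &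
    \forall i \near omega, (mi (B r i `\` (V i `|` W i)) <= e%:E)%E]) ->
  approximant C r !=set0.
Proof.
move=> exVW.
have /choice[VW VWP] : forall n : nat,
    exists VW : (forall i, set (X i)) * (forall i, set (X i)),
    [/\ ae_Ball omega VW.1, ae_Ball omega VW.2, PiO VW.1 `<=` C,
      PiO (omega := omega) VW.2 `<=` ~` C &
    \forall i \near omega, (mi (B r i `\` (VW.1 i `|` VW.2 i)) <= (n.+1%:R^-1)%:E)%E].
  by move=> n; have [|V [W VWP]] := exVW n.+1%:R^-1; [rewrite invr_gt0|exists (V, W)].
pose V n i := (VW n).1 i; pose W n i := (VW n).2 i.
have VW0 m n : \forall i \near omega, V m i `&` W n i `&` B r i `<=` set0.
  apply: (@rep_bounded_sub _ (fun=> set0) r); first by apply: nearW => i x [].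
  move=> u /PiOE uVW; exfalso.
  have [_ _ VC _ _] := VWP m; have [_ _ _ WC _] := VWP n.
  apply: (WC u); first by apply/PiOE; apply: filterS uVW => i [[]].
  by apply: VC; apply/PiOE; apply: filterS uVW => i [[]].
(* Disjointness is recorded for both orders of the indices, so that it holds for every pair of
   indices up to [n_ i]. *)
pose P n i := Ball (V n i) /\ forall m, (m <= n)%N ->
  V m i `&` W n i `&` B r i `<=` set0 /\ V n i `&` W m i `&` B r i `<=` set0.
have [|n_ [n_oo n_P]] := @near_diagonal P.
  move=> n; apply: filterI; first by case: (VWP n).
  by apply: near_forall_le => m; apply: filterI; exact: VW0.
pose U i := \big[setU/set0]_(m < (n_ i).+1) V m i `&` B r i.
exists (PiO U); split.
  exists U => //; apply: filterS n_P => i Pi; apply: BallI; last exact: Ball_ball.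
  apply/Ball_borel; apply: bigsetU_measurable => m _; apply/Ball_borel.
  by have [] := Pi m; rewrite // -ltnS.
apply/nullP => e e0; have [n ne] := exists_natSinv_lt e0.
have [mV mW VC WC Vn] := VWP n.
have mE : ae_Ball omega (fun i => B r i `\` (V n i `|` W n i)).
  apply: filterS2 mV mW => i mVi mWi.
  by apply: BallD; [exact: Ball_ball|exact: BallU].
exists (fun i => B r i `\` (V n i `|` W n i)); split => //; last first.
  apply: premeasure_le => // s; apply: filterS2 mE Vn => i mEi Vni.
  apply: le_trans (le_trans (Ball_le _ mEi _) Vni) _.
  - by apply: BallI => //; exact: Ball_ball.
  - by move=> x [].
  - by rewrite lee_fin ltW.
(* If [u] lies in [C] and the ball but not in [U], it avoids [W n], which is outside [C], and [V n],
   which is part of [U] on the ball once [n <= n_ i]. *)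
move=> u [[[Cu /PiOE Bu] /PiOC nUu]|[/PiOE Uu nCu]]; apply/PiOE.
  have /PiOC nWu : ~ PiO (W n) u by move=> /WC.
  apply: filterS2 (filterI Bu nWu) (filterI nUu (n_oo n)) => i [Bi nWi] [nUi ni].
  split => // -[Vi|//]; apply: nUi; split => //.
  by rewrite -(bigcup_mkord _ (V^~ i)); exists n.
(* If [u] lies in [U], hence in the ball, but not in [C], it avoids [V n]; and being in some [V m i]
   with [m <= n_ i] it avoids [W n i] by disjointness. *)
have /PiOC nVu : ~ PiO (V n) u.
  move=> /VC Cu; apply: nCu; split => //.
  by apply/PiOE; apply: filterS Uu => i [].
apply: filterS2 (filterI Uu nVu) (filterI n_P (n_oo n)) => i [[Ui Bi] nVi] [Pi ni].
split => // -[//|Wi].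
move: Ui; rewrite -(bigcup_mkord _ (V^~ i)) => -[m /= mn Vmi]; rewrite ltnS in mn.
have [mn'|nm] := leqP m n.
  by have [_ /(_ m mn')[+ _]] := Pi n ni; apply; split; [split; [exact: Vmi|exact: Wi]|].
have [_ /(_ n (ltnW nm))[_ +]] := Pi m mn.
by apply; split; [split; [exact: Vmi|exact: Wi]|].
Qed.

Variable U : set (Obar omega X).
Hypothesis appU : approximant C r U.

Let UE (e : R) : 0 < e -> exists A E, [/\ ae_Ball omega A, ae_Ball omega E,
  PiO A = U /\ mbarO U = premeasure omega A,
  (C `&` PiO (B r)) `+` U `<=` PiO E &
  forall s, \forall i \near omega, (mi (E i `&` B s i) < e%:E)%E].
Proof.
move=> e0; have [AU /nullP nU] := appU; have [A [mA AUE UA]] := mbarOP AU.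
have [|E [mE UE Ee]] := nU (e / 2); first by rewrite divr_gt0.
exists A, E; split => //; apply: premeasure_lt => //.
by apply: le_lt_trans Ee _; rewrite lte_fin; lra.
Qed.

(** A point of [U] is either in [C] and the ball, hence outside [W], or in the null difference,
    covered by some [E] of small mass. *)
Lemma approximant_ub W c : ae_Ball omega W -> PiO (omega := omega) W `<=` ~` C ->
  (\forall i \near omega, (mi (B r i `\` W i) <= c)%E) -> (mbarO U <= c)%E.
Proof.
move=> mW WC Wc; apply/lee_addgt0Pr => e e0.
have [A [E [mA mE [AU ->] CUE Ee]]] := UE e0.
apply: premeasure_le => // s.
have ArE : \forall i \near omega, A i `&` B s i `<=` (B r i `\` W i) `|` E i.
  apply: (@rep_bounded_sub _ _ s); first by apply: nearW => i x [].
  move=> u /PiOE Au; have Uu : U u by rewrite -AU; apply/PiOE; apply: filterS Au => i [].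
  apply/PiOE; have [[Cu /PiOE Bu]|nCu] := pselect ((C `&` PiO (B r)) u).
    have /PiOC nWu : ~ PiO W u by move=> /WC.
    by apply: filterS2 Bu nWu => i Bi Wi; left.
  have /CUE/PiOE Eu : ((C `&` PiO (B r)) `+` U) u by right.
  by apply: filterS Eu => i Ei; right.
apply: filterS2 (filterI mA mE) (filterI (filterI mW Wc) (filterI ArE (Ee s))).
move=> i [mAi mEi] [[mWi Wi] [AEi Ei]].
apply: le_trans (leeD Wi (ltW Ei)).
apply: Ball_leU.
- by apply: BallI => //; exact: Ball_ball.
- by apply: BallD => //; exact: Ball_ball.
- by apply: BallI => //; exact: Ball_ball.
- by move=> x [Ax Bx]; have [] := AEi x (conj Ax Bx); [left|right].
Qed.

(** A point of [V] in the ball belongs to [C], so it is in [U] or in the null difference. *)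
Lemma approximant_lb V c : ae_Ball omega V -> PiO (omega := omega) V `<=` C ->
  (\forall i \near omega, (c <= mi (V i `&` B r i))%E) -> (c <= mbarO U)%E.
Proof.
move=> mV VC Vc; apply/lee_addgt0Pr => e e0.
have [A [E [mA mE [AU ->] CUE Ee]]] := UE e0.
rewrite -leeBlDr//; apply: (@premeasure_ge _ r) => //.
have VAE : \forall i \near omega, V i `&` B r i `<=` A i `|` E i.
  apply: (@rep_bounded_sub _ _ r); first by apply: nearW => i x [].
  move=> u /PiOE Vu; apply/PiOE.
  have Cu : (C `&` PiO (B r)) u.
    by split; [apply: VC|]; apply/PiOE; apply: filterS Vu => i [].
  have [|nUu] := pselect (U u).
    by rewrite -AU => /PiOE Au; apply: filterS Au => i Ai; left.
  have /CUE/PiOE Eu : ((C `&` PiO (B r)) `+` U) u by left.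
  by apply: filterS Eu => i Ei; right.
apply: filterS2 (filterI mA mE) (filterI (filterI mV Vc) (filterI VAE (Ee r))).
move=> i [mAi mEi] [[mVi Vi] [AEi Ei]].
rewrite leeBlDr//; apply: le_trans Vi _; apply: le_trans (leeD (lexx _) (ltW Ei)).
apply: Ball_leU; [by apply: BallI => //; exact: Ball_ball..|].
by move=> x [Vx Bx]; have [] := AEi x (conj Vx Bx); [left|right].
Qed.

End approximant.

End internal.

(** * Weak convergence tested on neighbourhoods *)

Section integral_bounds.
Context {R : realType} (T : ppolishType R).
Variable mu : {measure set (borel T) -> \bar R}.
Variables (D A : set (borel T)) (f : borel T -> R).
Hypotheses (mD : measurable D) (mA : measurable A) (mf : measurable_fun setT f).
Hypothesis f0 : forall x, 0 <= f x.
Local Open Scope ereal_scope.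

Lemma integral_le_measure : (forall x, D x -> (f x <= \1_A x)%R) ->
  \int[mu]_(x in D) (f x)%:E <= mu A.
Proof.
move=> fA; apply: (@le_trans _ _ (\int[mu]_(x in D) (\1_A x)%:E)).
  apply: ge0_le_integral => //.
  - by move=> x _; rewrite lee_fin.
  - by apply/measurable_EFinP; exact: measurable_funTS.
  - by apply/measurable_EFinP; apply: measurable_funTS; exact: measurable_indic.
by rewrite integral_indic//; apply: le_measure; rewrite ?inE//; exact: measurableI.
Qed.

Lemma measure_le_integral : A `<=` D -> (forall x, D x -> (\1_A x <= f x)%R) ->
  mu A <= \int[mu]_(x in D) (f x)%:E.
Proof.
move=> AD fA; apply: (@le_trans _ _ (\int[mu]_(x in D) (\1_A x)%:E)).
  by rewrite integral_indic// setIidl.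
apply: ge0_le_integral => //.
- by apply/measurable_EFinP; apply: measurable_funTS; exact: measurable_indic.
- by apply/measurable_EFinP; exact: measurable_funTS.
Qed.

End integral_bounds.

Lemma continuous_borel (R : realType) (T : ptopologicalType) (f : T -> R) :
  continuous f -> measurable_fun [set: borel T] (f : borel T -> R).
Proof.
move=> /continuousP cf; apply: (measurability _ (RGenOpens.measurableE R)).
move=> _ [_ [a [b ->] <-]]; rewrite setTI.
apply: sub_sigma_algebra; apply: cf.
exact: interval_open.
Qed.

Section bump.
Context {R : realType} (T : ppolishType R).

Definition bump (r s : R) (x : T) : R := 1 - tent (ball point r) (s - r) x.

Variables (r s : R).
Hypothesis rs : r < s.
Let rs0 : 0 < s - r. Proof. by rewrite subr_gt0. Qed.

Lemma bump_ge0 x : 0 <= bump r s x.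
Proof. by rewrite subr_ge0 tent_le1. Qed.

Lemma bump_le1 x : bump r s x <= 1.
Proof. by rewrite lerBlDr lerDl tent_ge0. Qed.

Lemma bump_eq1 x : ball point r x -> bump r s x = 1.
Proof. by move=> rx; rewrite /bump tent_eq0// subr0. Qed.

Lemma bump_eq0 x : ~ ball point s x -> bump r s x = 0.
Proof.
move=> sx; rewrite /bump tent_eq1// ?subrr// => -[y].
rewrite !ballEmdist /= => ry yx; apply: sx; rewrite ballEmdist /=.
have := metric_triangle point y x; lra.
Qed.

Lemma bump_continuous : continuous (bump r s).
Proof.
by move=> x; apply: continuousB; [exact: cst_continuous|exact: tent_continuous].
Qed.

Lemma Cbbs_bumpM (g : T -> R) : continuous g -> (forall x, 0 <= g x <= 1) ->
  Cbbs (fun x => bump r s x * g x).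
Proof.
move=> cg g01; split.
- by move=> x; apply: continuousM; [exact: bump_continuous|exact: cg].
- exists 1 => x; have /andP[g0 g1] := g01 x.
  rewrite ger0_norm ?mulr_ge0 ?bump_ge0//.
  by rewrite mulr_ile1 ?bump_ge0 ?bump_le1.
(* The support lies in the closed ball of radius [s]; the larger radius turns it into an open
   ball. *)
- exists (s + 1); apply: (@subset_trans _ [set x | mdist point x <= s]).
    rewrite closureE; apply: smallest_sub; first exact: mdist_le_closed.
    move=> x /=; apply: contraNP => /negP; rewrite -ltNge => sx.
    rewrite bump_eq0 ?mul0r//= ballEmdist /=; lra.
  by move=> x /= sx; rewrite ballEmdist /=; lra.
Qed.

End bump.

Section pmGH.
Context {R : realType} (omega : set_system nat) {UO : UltraFilter omega}.
Hypothesis np : non_principal omega.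
Variables (X : nat -> pmmSpace R) (Y : pmmSpace R) (rho eps : nat -> R).
Variable psi : forall i, X i -> Y.
Arguments psi : clear implicits.
Hypothesis finY : boundedly_finite Y.
Hypothesis psiP : pmGH_by rho eps psi.

Lemma near_rho_gt (a : R) : \forall i \near omega, a < rho i.
Proof.
have [[_ rhoy] _ _ _] := psiP; apply: (non_principal_cofinite np).
by move/cvgryPgt : rhoy; apply.
Qed.

Lemma near_eps_lt (e : R) : 0 < e -> \forall i \near omega, 0 < eps i < e.
Proof.
move=> e0; have [_ [_ eps0] psia _] := psiP.
apply: (non_principal_cofinite np).
move/cvgr0Pnorm_lt : eps0 => /(_ _ e0); apply: filterS => i /=.
by have [/andP[ei0 _] _ _ _ _] := psia i; rewrite gtr0_norm// ei0.
Qed.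

Lemma psi_dist i x y : ball point (rho i) x -> ball point (rho i) y ->
  `|mdist x y - mdist (psi i x) (psi i y)| <= eps i.
Proof. by have [_ _ /(_ i)[_ _ _ +] _] := psiP => + _; exact. Qed.

Lemma psi_point i x : ball point (rho i) x ->
  `|mdist point x - mdist point (psi i x)| <= eps i.
Proof.
move=> rx; have [_ _ /(_ i)[/andP[e0 er] _ p _ _] _] := psiP.
by rewrite -p; apply: psi_dist => //; apply: ballxx; exact: lt_trans er.
Qed.

(** The preimage is cut to the ball on which [psi i] is an approximation, which is also the domain
    of the integrals in the weak convergence. *)
Definition pull (C : set Y) (d : R) i : set (X i) :=
  [set x | ball point (rho i) x /\ nbr C d (psi i x)].

Arguments pull : clear implicits.

Lemma pull_Ball C d i : Ball (pull C d i).
Proof.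
apply/Ball_borel; have [_ _ /(_ i)[_ mpsi _ _ _] _] := psiP.
apply: measurableI; first by apply: open_borel; exact: ball_is_open.
rewrite -[X in measurable X]setTI; apply: mpsi => //.
by apply: open_borel; exact: nbr_open.
Qed.

Lemma pullU C D d i : pull (C `|` D) d i = pull C d i `|` pull D d i.
Proof.
rewrite /pull nbrU; apply/seteqP; split => x /=; tauto.
Qed.

Lemma near_pmGH_lt h (c : \bar R) : @Cbbs R Y h -> (\int['m_Y]_x (h x)%:E < c)%E ->
  \forall i \near omega,
    (\int['m_(X i)]_(x in ball point (rho i)) (h (psi i x))%:E < c)%E.
Proof.
move=> hC hc; have [_ _ _ /(_ _ hC) cvh] := psiP.
exact/(non_principal_cofinite np)/(cvge_near_lt cvh).
Qed.

Lemma near_pmGH_gt h (c : \bar R) : @Cbbs R Y h -> (c < \int['m_Y]_x (h x)%:E)%E ->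
  \forall i \near omega,
    (c < \int['m_(X i)]_(x in ball point (rho i)) (h (psi i x))%:E)%E.
Proof.
move=> hC hc; have [_ _ _ /(_ _ hC) cvh] := psiP.
exact/(non_principal_cofinite np)/(cvge_near_gt cvh).
Qed.

Lemma psi_comp_measurable i (h : Y -> R) : continuous h ->
  measurable_fun [set: borel (X i)] (h \o psi i : borel (X i) -> R).
Proof.
move=> ch; have [_ _ /(_ i)[_ mpsi _ _ _] _] := psiP.
by apply: measurableT_comp mpsi; exact: continuous_borel.
Qed.

Lemma tent01 (C : set Y) d x : 0 < d -> 0 <= tent C d x <= 1.
Proof. by move=> d0; rewrite tent_ge0// tent_le1. Qed.

(** The test function vanishes on [C] and outside [ball point (r + 1)], and is 1 on
    [ball point (r + 2^-1)] away from [nbr C d]. Since [psi i] changes distances to the base point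
    by less than 1/2, its pull-back dominates the indicator on the left. *)
Lemma near_pull_ub (C : set Y) (r d e : R) : measurable (C : set (borel Y)) ->
  0 < d -> 0 < e -> \forall i \near omega,
    ('m_(X i) (ball point r `\` pull C d i) <=
     'm_Y (ball point (r + 1) `\` C) + e%:E)%E.
Proof.
move=> mC d0 e0.
have h20 : 0 < 2^-1 :> R by rewrite invr_gt0.
pose f (y : Y) := bump (r + 2^-1) (r + 1) y * tent C d y.
have rr : r + 2^-1 < r + 1 by lra.
have fC : Cbbs f by apply: Cbbs_bumpM => // x; [exact: tent_continuous|exact: tent01].
have f0 y : 0 <= f y by rewrite mulr_ge0 ?bump_ge0 ?tent_ge0.
have mB : measurable (ball point (r + 1) : set (borel Y)).
  by apply: open_borel; exact: ball_is_open.
have cf : continuous f by case: fC.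
have intf : (\int['m_Y]_x (f x)%:E <= 'm_Y (ball point (r + 1) `\` C))%E.
  apply: integral_le_measure => //; [exact: measurableD|exact: continuous_borel|].
  move=> x _; rewrite indicE; case: (boolP (x \in _)) => [_|/negP].
    by rewrite mulr_ile1 ?bump_ge0 ?bump_le1 ?tent_ge0 ?tent_le1.
  rewrite inE => nx; have [Bx|nBx] := pselect (ball point (r + 1) x).
    by rewrite /f tent_eq0 ?mulr0//; apply: contrapT => nCx; exact: nx.
  by rewrite /f bump_eq0// mul0r.
have /near_pmGH_lt : (\int['m_Y]_x (f x)%:E <
    'm_Y (ball point (r + 1) `\` C) + e%:E)%E.
  (* Finiteness of the mass on balls makes the inequality strict, and a strict bound on the limit
     passes to almost every [i]. *)
  apply: le_lt_trans intf _; rewrite lteDl ?lte_fin// ge0_fin_numE//.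
  apply: le_lt_trans (finY point (r + 1)); apply: le_measure; rewrite ?inE//.
  exact: measurableD.
move=> /(_ fC) fi.
apply: filterS3 fi (near_rho_gt r) (near_eps_lt h20) => i fi ri /andP[_ ei].
apply: (le_trans _ (ltW fi)).
have mBi s : measurable (ball point s : set (borel (X i))).
  by apply: open_borel; exact: ball_is_open.
have Bsub : ball point r `<=` ball (point : X i) (rho i) by apply: le_ball; exact: ltW.
apply: (@measure_le_integral _ (X i) _ _ _ (f \o psi i)) => //.
- by apply: measurableD => //; apply/Ball_borel; exact: pull_Ball.
- exact: psi_comp_measurable.
- by move=> x [/Bsub].
move=> x Rx /=; rewrite indicE; case: (boolP (x \in _)) => [|_]; last exact: f0.
rewrite inE => -[Bx nCx]; rewrite /f bump_eq1 ?tent_eq1 ?mulr1//.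
  by move=> Cx; exact: nCx.
have := psi_point Rx; move: Bx; rewrite !ballEmdist /= ler_norml => ? /andP[? ?]; lra.
Qed.

(** Dually, the test function is 1 on [C] inside [ball point (r - 1)] and vanishes off [nbr C d] and
    off [ball point (r - 2^-1)]; its pull-back is at most the indicator of the set on the right. *)
Lemma near_pull_lb (C : set Y) (r d e : R) : measurable (C : set (borel Y)) ->
  0 < d -> 0 < e -> \forall i \near omega,
    ('m_Y (C `&` ball point (r - 1)) <=
     'm_(X i) (pull C d i `&` ball point r) + e%:E)%E.
Proof.
move=> mC d0 e0.
have h20 : 0 < 2^-1 :> R by rewrite invr_gt0.
pose f (y : Y) := bump (r - 1) (r - 2^-1) y * (1 - tent C d y).
have rr : r - 1 < r - 2^-1 by lra.
have tent01' y : 0 <= 1 - tent C d y <= 1.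
  by have := tent01 C y d0; lra.
have fC : Cbbs f.
  apply: Cbbs_bumpM => // x.
  by apply: continuousB; [exact: cst_continuous|exact: tent_continuous].
have f0 y : 0 <= f y by have /andP[? _] := tent01' y; rewrite mulr_ge0 ?bump_ge0.
have mB : measurable (ball point (r - 1) : set (borel Y)).
  by apply: open_borel; exact: ball_is_open.
have cf : continuous f by case: fC.
have intf : ('m_Y (C `&` ball point (r - 1)) <= \int['m_Y]_x (f x)%:E)%E.
  apply: measure_le_integral => //; [exact: measurableI|exact: continuous_borel|].
  move=> x _; rewrite indicE; case: (boolP (x \in _)) => [|_]; last exact: f0.
  by rewrite inE => -[Cx Bx]; rewrite /f tent_eq0// bump_eq1// subr0 mulr1.
have : ('m_Y (C `&` ball point (r - 1)) - e%:E < \int['m_Y]_x (f x)%:E)%E.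
  apply: lt_le_trans intf; rewrite lteBlDr// lteDl ?lte_fin// ge0_fin_numE//.
  apply: le_lt_trans (finY point (r - 1)); apply: le_measure; rewrite ?inE//.
  exact: measurableI.
move=> /(near_pmGH_gt fC) fi.
apply: filterS2 fi (near_eps_lt h20) => i fi /andP[_ ei].
rewrite -leeBlDr//; apply: (le_trans (ltW fi)).
have mBi s : measurable (ball point s : set (borel (X i))).
  by apply: open_borel; exact: ball_is_open.
apply: (@integral_le_measure _ (X i) _ _ _ (f \o psi i)) => //.
- by apply: measurableI => //; apply/Ball_borel; exact: pull_Ball.
- exact: psi_comp_measurable.
- by move=> x; exact: f0.
move=> x Rx /=; rewrite indicE; case: (boolP (x \in _)) => [_|/negP].
  by have /andP[? ?] := tent01' (psi i x); rewrite mulr_ile1 ?bump_ge0 ?bump_le1.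
rewrite inE => nx; have [Bx|nBx] := pselect (ball point (r - 2^-1) (psi i x)); last first.
  by rewrite /f bump_eq0// mul0r.
rewrite /f tent_eq1 ?subrr ?mulr0// => Cx; apply: nx; split => //.
have := psi_point Rx; move: Bx; rewrite !ballEmdist /= ler_norml => ? /andP[? ?]; lra.
Qed.

End pmGH.

(** * The ultralimit measure as a push-forward *)

Section pmGH_ultralimit.
Context {R : realType} (omega : set_system nat) {UO : UltraFilter omega}.
Hypothesis np : non_principal omega.
Variables (X : nat -> pmmSpace R) (Y : pmmSpace R) (rho eps : nat -> R).
Variables (psi : forall i, X i -> Y) (phi : forall i, Y -> X i).
Arguments psi : clear implicits.
Arguments phi : clear implicits.
Hypothesis finY : boundedly_finite Y.
Hypothesis psiP : pmGH_by rho eps psi.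
Hypothesis phiP : forall i, 4 * eps i < rho i ->
  quasi_inverse (rho i) (eps i) (psi i) (phi i).
Local Notation phi_oo := (phi_infty np psiP phiP).
Local Notation pull C d i := (@pull R X Y rho psi C d i).

Lemma rep_phi (k : Y) :
  \forall i \near omega, rep (SigSub (phi_family_Obar np psiP phiP k)) i = phi i k.
Proof.
apply: filterS2 (repr_family (phi_family np phi psiP k))
  (quasi_inverse_dom np psiP) => i ri dom.
by rewrite /rep /= /family_val ri /= dom.
Qed.

(** The points [psi i (rep u i)] are ever closer to points [k_ i] of [K], which converge along
    [omega] to some [p] in [K] by compactness. As [phi i] is a quasi-inverse and almost an isometry,
    [rep u i] is close to [phi i p]. *)
Lemma PiO_pull_compact (K : set Y) (A : forall i, set (X i)) : compact K ->
  (forall d, 0 < d -> \forall i \near omega, A i `<=` pull K d i) ->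
  PiO A `<=` [set u | (phi_oo @` K) (\pi_(ultralimit omega X)%qT u)].
Proof.
move=> cK AK u /PiOE Au.
have invn0 n : 0 < n.+1%:R^-1 :> R by rewrite invr_gt0.
have [|n_ [n_oo n_P]] := near_diagonal np
    (P := fun n i => exists2 k, K k & mdist k (psi i (rep u i)) < n.+1%:R^-1).
  move=> n; apply: filterS2 Au (AK _ (invn0 n)) => i Ai /(_ _ Ai)[_ [k Kk]].
  by rewrite ballEmdist; exists k.
pose k_ i := xget (point : Y)
  [set k | K k /\ mdist k (psi i (rep u i)) < (n_ i).+1%:R^-1].
have kP : \forall i \near omega,
    K (k_ i) /\ mdist (k_ i) (psi i (rep u i)) < (n_ i).+1%:R^-1.
  apply: filterS n_P => i /(_ _ (leqnn _))[k Kk kd].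
  exact: (@xgetPex Y point [set k | K k /\
    mdist k (psi i (rep u i)) < (n_ i).+1%:R^-1] (ex_intro _ k (conj Kk kd))).
have [|p [Kp clp]] := cK (k_ @ omega) _.
  by apply: filterS kP => i [].
(* A cluster point of an ultrafilter is a limit: otherwise almost all [k_ i] would stay at distance
   at least [e] from [p]. *)
have near_p (e : R) : 0 < e -> \forall i \near omega, mdist p (k_ i) < e.
  move=> e0; have [//|nope] := in_ultra_setVsetC [set i | mdist p (k_ i) < e] UO.
  have [q [[i ki <-]]] : k_ @` (~` [set i | mdist p (k_ i) < e]) `&` ball p e !=set0.
    apply: clp; last exact: nbhsx_ballx.
    change (omega (k_ @^-1` (k_ @` (~` [set i | mdist p (k_ i) < e])))).
    by apply: filterS nope => i; exists i.
  by rewrite ballEmdist.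
exists p => //; apply/esym/rep_pi_eq => e e0.
have [s us] := rep_bounded u.
have e80 : 0 < e / 8 by rewrite divr_gt0.
have [n ne] := exists_natSinv_lt e80.
(* Once [rho i] exceeds [a], the points [rep u i], its image under [psi i] and [p] lie in all the
   balls where the estimates for [psi i] and [phi i] apply. *)
pose a := `|s| + mdist point p + e + 3.
near=> i.
have -> : rep (SigSub (phi_family_Obar np psiP phiP p)) i = phi i p.
  by near: i; exact: rep_phi.
have rhoa : a < rho i by near: i; exact: (near_rho_gt np psiP).
have us' : ball point s (rep u i) by near: i.
have pk : mdist p (k_ i) < e / 8 by near: i; exact: near_p.
have [_ kpsi] : K (k_ i) /\ mdist (k_ i) (psi i (rep u i)) < (n_ i).+1%:R^-1.
  by near: i.
have ni : (n <= n_ i)%N by near: i; exact: n_oo.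
have /andP[eps0 eps1] : 0 < eps i < 1 / 8.
  by near: i; apply: (near_eps_lt np psiP) => //; rewrite divr_gt0.
have /andP[_ epse] : 0 < eps i < e / 8 by near: i; exact: (near_eps_lt np psiP).
have nn : (n_ i).+1%:R^-1 <= n.+1%:R^-1 :> R by rewrite lef_pV2 ?posrE ?ltr0n ?ler_nat.
have {nn} kpsi : mdist (k_ i) (psi i (rep u i)) < e / 8.
  exact: lt_trans (lt_le_trans kpsi nn) ne.
have s_le := ler_norm s.
have p0 : 0 <= mdist point p by exact: mdist_ge0.
have s0 := normr_ge0 s.
have dom : 4 * eps i < rho i by move: rhoa; rewrite /a; lra.
have [[_ _ _ iso _] inv _] := phiP dom.
move: us'; rewrite ballEmdist /= => us'.
have psiu : `|mdist point (rep u i) - mdist point (psi i (rep u i))| <= eps i.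
  by apply: (psi_point psiP); rewrite ballEmdist /=; move: rhoa; rewrite /a; lra.
have inu : mdist (rep u i) (phi i (psi i (rep u i))) < 3 * eps i.
  by apply: inv; rewrite ballEmdist /=; move: rhoa; rewrite /a; lra.
have isou : `|mdist (psi i (rep u i)) p -
    mdist (phi i (psi i (rep u i))) (phi i p)| <= 3 * eps i.
  move: psiu; rewrite ler_norml => /andP[? ?].
  by apply: iso; rewrite ballEmdist /=; move: rhoa; rewrite /a; lra.
(* The total error is below [6 * eps i + e/8 + e/8], hence below [e]: [3 * eps i] each for the
   quasi-inverse and the distortion of [phi i], [e/8] each for the distances of [k_ i] to [p] and to
   the image of [rep u i]. *)
have t1 := metric_triangle (rep u i) (phi i (psi i (rep u i))) (phi i p).
have t2 := metric_triangle p (k_ i) (psi i (rep u i)).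
rewrite (metric_sym _ p) in isou.
move: isou; rewrite ler_norml => /andP[? ?]; lra.
Unshelve. all: by end_near. Qed.

(** The measure is finite only on balls, so regularity is applied to its restriction to one ball. *)
Lemma bounded_regular (B : set (borel Y)) (s e : R) : measurable B -> 0 < e ->
  exists K : set Y, [/\ compact K, K `<=` B `&` ball point s &
    ('m_Y ((B `&` ball point s) `\` K) <= e%:E)%E].
Proof.
move=> mB e0; have mb : measurable (ball point s : set (borel Y)).
  by apply: open_borel; exact: ball_is_open.
have fin : (mrestr 'm_Y mb setT < +oo)%E by rewrite /mrestr setTI; exact: finY.
have [_ /(_ _ e0)[K [cK KB Ke]]] := borel_approximable fin (measurableI _ _ mB mb).
exists K; split => //; apply: (le_trans _ Ke).
have KE : ((B `&` ball point s) `\` K) `&` ball point s = (B `&` ball point s) `\` K.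
  by apply: setIidl => x [[]].
by rewrite -{1}KE.
Qed.

Section ball_set.
Variable A : set (ultralimit omega X).
Hypothesis mA : Ball A.
Let B : set (borel Y) := phi_oo @^-1` A.
Let C : set (Obar omega X) := \pi_(ultralimit omega X)%qT @^-1` A.

Let mB : measurable B.
Proof.
rewrite /B -[X in measurable X]setTI.
exact: (measurable_phi_infty np psiP phiP).
Qed.

Let mball s : measurable (ball point s : set (borel Y)).
Proof. by apply: open_borel; exact: ball_is_open. Qed.

Lemma internal_sandwich (r e : R) : 0 < e -> exists V W,
  [/\ ae_Ball omega V /\ ae_Ball omega W,
    PiO V `<=` C /\ PiO (omega := omega) W `<=` ~` C,
    \forall i \near omega,
      ('m_(X i) (ball point r `\` (V i `|` W i)) <= e%:E)%E,
    \forall i \near omega,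
      ('m_(X i) (ball point r `\` W i) <= 'm_Y B + e%:E)%E &
    \forall i \near omega,
      ('m_Y (B `&` ball point (r - 1)) <= 'm_(X i) (V i `&` ball point r) + e%:E)%E].
Proof.
(* One third of [e] each for the mass missed by [K], the mass missed by [L], and the passage to the
   limit. *)
move=> e0; have e30 : 0 < e / 3 by rewrite divr_gt0.
have eE : e%:E = (e / 3)%:E + (e / 3)%:E + (e / 3)%:E by rewrite -!EFinD; congr EFin; lra.
have [K [cK KB Ke]] := bounded_regular (r + 1) mB e30.
have [L [cL LB Le]] := bounded_regular (r + 1) (measurableC mB) e30.
have mK := compact_borel cK; have mL := compact_borel cL.
have mKL : measurable (K `|` L : set (borel Y)) by exact: measurableU.
pose d n : R := n.+1%:R^-1.
have d0 n : 0 < d n by rewrite invr_gt0.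
have mD1 : measurable ((B `&` ball point (r + 1)) `\` K).
  by apply: measurableD => //; exact: measurableI.
have mD2 : measurable ((~` B `&` ball point (r + 1)) `\` L).
  by apply: measurableD => //; apply: measurableI => //; exact: measurableC.
have muKL : ('m_Y (ball point (r + 1) `\` (K `|` L)) <= (e / 3)%:E + (e / 3)%:E)%E.
  apply: (le_trans _ (leeD Ke Le)); apply: (le_trans _ (measureU2 _ mD1 mD2)).
  apply: le_measure; rewrite ?inE; [exact: measurableD|exact: measurableU|].
  move=> x [bx nKL]; have [Bx|nBx] := pselect (B x).
    by left; split => // Kx; apply: nKL; left.
  by right; split => // Lx; apply: nKL; right.
have muL : ('m_Y (ball point (r + 1) `\` L) <= 'm_Y B + (e / 3)%:E)%E.
  apply: (le_trans _ (leeD (lexx _) Le)); apply: (le_trans _ (measureU2 _ mB mD2)).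
  apply: le_measure; rewrite ?inE; [exact: measurableD|exact: measurableU|].
  by move=> x [bx nL]; have [Bx|nBx] := pselect (B x); [left|right].
have muK : ('m_Y (B `&` ball point (r - 1)) <=
    'm_Y (K `&` ball point (r - 1)) + (e / 3)%:E)%E.
  apply: (le_trans _ (leeD (lexx _) Ke)).
  apply: (le_trans _ (measureU2 _ (measurableI _ _ mK (mball (r - 1))) mD1)).
  apply: le_measure; rewrite ?inE; [exact: measurableI| |].
    by apply: measurableU => //; exact: measurableI.
  move=> x [Bx bx]; have [Kx|nKx] := pselect (K x); [by left|right].
  by split => //; split => //; apply: le_ball bx; lra.
(* The three mass estimates hold for each fixed radius [d n]; the diagonal index keeps them while
   the radius [d (n_ i)] shrinks to 0. *)
have [|n_ [n_oo n_P]] := near_diagonal np (P := fun n i =>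
    [/\ ('m_(X i) (ball point r `\` (pull K (d n) i `|` pull L (d n) i)) <= e%:E)%E,
      ('m_(X i) (ball point r `\` pull L (d n) i) <= 'm_Y B + e%:E)%E &
      ('m_Y (B `&` ball point (r - 1)) <=
       'm_(X i) (pull K (d n) i `&` ball point r) + e%:E)%E]).
  move=> n.
  apply: filterS3 (near_pull_ub np finY psiP r mKL (d0 n) e30)
    (near_pull_ub np finY psiP r mL (d0 n) e30)
    (near_pull_lb np finY psiP r mK (d0 n) e30) => i KLi Li Ki; split.
  - by rewrite -pullU eE; apply: le_trans KLi _; rewrite leeD2r.
  - apply: le_trans Li _; apply: le_trans (leeD muL (lexx _)) _.
    by rewrite -addeA leeD2l// -EFinD lee_fin; lra.
  - apply: le_trans muK _; apply: le_trans (leeD Ki (lexx _)) _.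
    by rewrite -addeA leeD2l// -EFinD lee_fin; lra.
have pull_le (D : set Y) t : 0 < t ->
    \forall i \near omega, pull D (d (n_ i)) i `<=` pull D t i.
  move=> t0; have [n nt] := exists_natSinv_lt t0.
  apply: filterS (n_oo n) => i ni x [? nb]; split => //.
  apply: nbr_le nb; apply: le_trans (ltW nt).
  by rewrite lef_pV2 ?posrE ?ltr0n ?ler_nat.
exists (fun i => pull K (d (n_ i)) i), (fun i => pull L (d (n_ i)) i); split.
- by split; apply: nearW => i; exact: (pull_Ball psiP).
- split => u.
    move=> /(PiO_pull_compact cK (pull_le K))[k /KB[Bk _] ku].
    by have : A (phi_oo k) by []; rewrite ku.
  move=> /(PiO_pull_compact cL (pull_le L))[k /LB[nBk _] ku] Cu.
  by apply: nBk; rewrite /B /preimage /= ku.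
- by apply: filterS n_P => i /(_ _ (leqnn _))[].
- by apply: filterS n_P => i /(_ _ (leqnn _))[].
- by apply: filterS n_P => i /(_ _ (leqnn _))[].
Qed.

Lemma approximant_nonempty r : approximant C r !=set0.
Proof.
apply: approximant_exists => // e e0.
have [V [W [[mV mW] [VC WC] VWe _ _]]] := internal_sandwich r e0.
by exists V, W.
Qed.

Lemma mbarO_approximant r (U : set (Obar omega X)) : approximant C r U ->
  ('m_Y (B `&` ball point (r - 1)) <= mbarO U <= 'm_Y B)%E.
Proof.
move=> UP; apply/andP; split; apply/lee_addgt0Pr => e e0;
  have [V [W [[mV mW] [VC WC] _ We Ve]]] := internal_sandwich r e0.
  rewrite -leeBlDr//; apply: (approximant_lb UP mV VC).
  by apply: filterS Ve => i; rewrite leeBlDr.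
exact: (approximant_ub UP mW WC).
Qed.

(** Whatever approximant is picked at radius [r], its mass is squeezed between [g r] and the mass of
    [B], and [g r] increases to the latter. *)
Lemma measure_preimage_phi_infty : 'm_Y (phi_oo @^-1` A) = m_omega omega X A.
Proof.
pose g (r : R) := 'm_Y (B `&` ball point (r - 1)).
have mg r : measurable (B `&` ball point r) by exact: measurableI.
have ndg : nondecreasing_fun g.
  move=> r s rs; apply: le_measure; rewrite ?inE; [exact: mg|exact: mg|].
  by apply: setIS; apply: le_ball; lra.
have gB r : (g r <= 'm_Y B)%E.
  by apply: le_measure; rewrite ?inE; [exact: mg|exact: mB|move=> x []].
have cvg_g : g r @[r --> +oo] --> 'm_Y B.
  have := nondecreasing_cvge ndg; congr (_ --> _); apply/eqP; rewrite eq_le.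
  apply/andP; split; first by apply: ub_ereal_sup => _ [r _ <-].
  have BU : B = \bigcup_n (B `&` ball point n%:R).
    apply/seteqP; split => [y By|y [n _ []]//].
    have [n _ yn] : exists2 n : nat, True & mdist point y < n%:R.
      by exists (Num.bound (mdist point y)) => //; apply: archi_boundP; exact: mdist_ge0.
    by exists n => //; split => //; rewrite ballEmdist.
  have cvB : 'm_Y (B `&` ball point n%:R) @[n --> \oo] --> 'm_Y B.
    rewrite {2}BU; apply: nondecreasing_cvg_mu => //.
      by rewrite -BU.
    move=> m n mn; apply/subsetPset; apply: setIS; apply: le_ball.
    by rewrite ler_nat.
  rewrite -(cvg_lim _ cvB)//; apply: lime_le; first by apply/cvg_ex; exists ('m_Y B).
  (* The radius [n + 1] undoes the shift by 1 in [g]. *)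
  apply: nearW => n; apply: ereal_sup_ubound; exists (n%:R + 1) => //.
  by rewrite /g addrK.
rewrite /m_omega /mbar -/C; apply/esym/cvg_lim => //.
apply: (@squeeze_cvge _ _ _ _ g _ (fun=> 'm_Y B)); [|exact: cvg_g|exact: cvg_cst].
apply: nearW => r; apply: mbarO_approximant.
by apply: xgetPex; exact: approximant_nonempty.
Qed.

End ball_set.

End pmGH_ultralimit.

(** * Supports *)

Section support.
Context {R : realType} (T : ppolishType R).
Variable mu : {measure set (borel T) -> \bar R}.

(** Every point outside the support lies in a null ball of radius [1/(k+1)] around a point of the
    dense sequence, and there are countably many such balls. *)
Lemma setC_spt : exists G : nat -> set T,
  [/\ ~` spt mu = \bigcup_n G n, forall n, open (G n) & forall n, mu (G n) = 0%E].
Proof.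
have [s sP] := dense_sequence T.
pose B (nk : nat * nat) : set T := ball (s nk.1) (nk.2.+1%:R^-1 : R).
pose G n : set T := if unpickle n is Some nk then
  if `[< mu (B nk) = 0%E >] then B nk else set0 else set0.
exists G; split.
- apply/seteqP; split=> [y /existsNP[r /not_implyP[r0 /negP]]|y [n _]].
    rewrite lt0e measure_ge0 andbT negbK => /eqP yr.
    have [k kr] : exists k : nat, k.+1%:R^-1 < r / 2.
      by apply: exists_natSinv_lt; rewrite divr_gt0.
    have k0 : 0 < k.+1%:R^-1 :> R by rewrite invr_gt0.
    have [n ny] := sP y _ k0.
    exists (pickle (n, k)) => //; rewrite /G pickleK.
    case: asboolP => // -[].
    apply/eqP; rewrite eq_le measure_ge0 andbT -yr.
    apply: le_measure; rewrite ?inE; [by apply: open_borel; exact: ball_is_open..|].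
    apply: ball_subset_mdist.
    by move: ny kr; rewrite ballEmdist /= metric_sym; set a := _^-1; lra.
  rewrite /G; case: unpickle => // nk; case: asboolP => // Bnk By.
  have /nbhs_ballP[r /= r0 rB] := open_nbhs_nbhs (conj (ball_is_open _ _) By).
  move=> /(_ r r0); rewrite lt0e => /andP[/negP + _]; apply.
  rewrite eq_le measure_ge0 andbT -Bnk.
  by apply: le_measure; rewrite ?inE//; apply: open_borel; exact: ball_is_open.
- move=> n; rewrite /G; case: unpickle => [nk|]; last exact: open0.
  by case: asboolP => _; [exact: ball_is_open|exact: open0].
- move=> n; rewrite /G; case: unpickle => [nk|]; last exact: measure0.
  by case: asboolP => // _; exact: measure0.
Qed.

Lemma spt_closed : closed (spt mu).
Proof.
have [G [GE oG _]] := setC_spt.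
by rewrite -[spt mu]setCK GE; apply: open_closedC; exact: bigcup_open.
Qed.

Lemma measure_setC_spt : mu (~` spt mu) = 0%E.
Proof.
have [G [-> oG G0]] := setC_spt.
have mG n : measurable (G n : set (borel T)) by exact: open_borel.
apply/eqP; rewrite eq_le measure_ge0 andbT.
apply: (@le_trans _ _ (\sum_(n <oo) mu (G n))%E).
  by apply: measure_sigma_subadditive => //; exact: bigcupT_measurable.
by rewrite eseries0// => n _ _; exact: G0.
Qed.

End support.

(** * Closed isometric images of Polish spaces *)

Section isometry.
Context {R : realType} (T : ppolishType R) (Z : metricType R).
Variable f : T -> Z.
Hypothesis fiso : forall x y, mdist (f x) (f y) = mdist x y.

(** Points of [F] whose images approach [z] form a Cauchy sequence because [f] is isometric;
    completeness of the source gives the preimage of [z]. *)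
Lemma isometry_image_closed (F : set T) (z : Z) : closed F ->
  (forall e : R, 0 < e -> exists2 x, F x & mdist z (f x) < e) -> (f @` F) z.
Proof.
move=> cF zF.
have /choice[x xP] : forall n : nat, exists x, F x /\ mdist z (f x) < n.+1%:R^-1.
  by move=> n; have [|x Fx zx] := zF n.+1%:R^-1; [rewrite invr_gt0|exists x].
have xe (e : R) : 0 < e -> \forall n \near \oo, mdist z (f (x n)) < e.
  move=> e0; have [k ke] := exists_natSinv_lt e0.
  near=> n; have [_ /lt_trans] := xP n; apply; apply: le_lt_trans ke.
  by rewrite lef_pV2 ?posrE ?ltr0n// ler_nat ltnS; near: n; exact: nbhs_infty_ge.
have /cauchy_exP/cauchy_cvg cx : cauchy_ex (x @ \oo).
  move=> e e0; have e20 : 0 < e / 2 by rewrite divr_gt0.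
  have [k _ /(_ k (leqnn k)) zk] := xe _ e20.
  exists (x k); apply: filterS (xe _ e20) => n zn /=.
  rewrite ballEmdist /= -fiso; have := metric_triangle (f (x k)) z (f (x n)).
  by rewrite (metric_sym _ z); lra.
have Fx : F (lim (x @ \oo)).
  by apply: (@closed_cvg _ _ \oo _ x F cF _ _ cx); apply: nearW => n; case: (xP n).
exists (lim (x @ \oo)) => //; apply: mdist_positivity; apply/eqP.
rewrite eq_le mdist_ge0 andbT; apply/ler_addgt0Pl => e e0; rewrite addr0.
have e20 : 0 < e / 2 by rewrite divr_gt0.
have lx : \forall n \near \oo, mdist (lim (x @ \oo)) (x n) < e / 2.
  exact: (metricType_numDomainType.cvgr_dist_lt cx).
near \oo => n.
have a1 : mdist (lim (x @ \oo)) (x n) < e / 2 by near: n.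
have a2 : mdist z (f (x n)) < e / 2 by near: n; exact: xe.
have := metric_triangle (f (lim (x @ \oo))) (f (x n)) z.
by rewrite fiso (metric_sym (f (x n)) z); lra.
Unshelve. all: by end_near. Qed.

(** The target may be non-separable, so closedness is not enough. The image is instead a countable
    intersection of countable unions of balls centred on the image of a dense sequence. *)
Lemma Ball_setC_isometry_image (F : set T) : closed F -> Ball (~` (f @` F)).
Proof.
move=> cF; have [s sP] := dense_sequence T.
(* The centre [s k] need not be in [F], only within [1/(n+1)] of it; a point of the ball is then
   within [2/(n+1)] of the image of [F]. *)
pose G n k : set Z := if `[< exists2 x, F x & mdist (s k) x < n.+1%:R^-1 >]
  then ball (f (s k)) (n.+1%:R^-1 : R) else set0.
have -> : f @` F = \bigcap_n \bigcup_k G n k.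
  apply/seteqP; split=> [_ [x Fx <-] n _|z zG].
    have n0 : 0 < n.+1%:R^-1 :> R by rewrite invr_gt0.
    have [k] := sP x _ n0; rewrite ballEmdist /= => kx.
    exists k => //; rewrite /G; case: asboolP => [_|[]]; last by exists x.
    by rewrite ballEmdist /= fiso.
  apply: isometry_image_closed => // e e0.
  have [n ne] : exists n : nat, n.+1%:R^-1 < e / 2.
    by apply: exists_natSinv_lt; rewrite divr_gt0.
  have [k _] := zG n I; rewrite /G; case: asboolP => // -[x Fx kx].
  rewrite ballEmdist /= => kz; exists x => //.
  have := metric_triangle z (f (s k)) (f x); rewrite fiso (metric_sym z (f (s k))).
  by move: ne kx kz; set a := _^-1; lra.
rewrite setC_bigcap; apply: sigma_algebra_bigcup => n.
rewrite -setTD; apply: sigma_algebraCD; apply: sigma_algebra_bigcup => k.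
rewrite /G; case: asboolP => _; last exact: sigma_algebra0.
by apply: sub_sigma_algebra; exists (f (s k)), n.+1%:R^-1.
Qed.

End isometry.

(** * Push-forward, support and concentration of the ultralimit measure *)

Theorem theorem9p4 (R : realType)
  (omega : set_system nat) (UO : UltraFilter omega) (np : non_principal omega)
  (X : nat -> pmmSpace R) (Xoo : pmmSpace R)
  (finX : forall i, boundedly_finite (X i)) (finXoo : boundedly_finite Xoo)
  (rho eps : nat -> R) (psi : forall i, X i -> Xoo) (phi : forall i, Xoo -> X i)
  (psiP : pmGH_by rho eps psi)
  (phiP : forall i, 4 * eps i < rho i ->
    quasi_inverse (rho i) (eps i) (psi i) (phi i)) :
  let phi_oo : borel Xoo -> ball_type omega X := phi_infty np psiP phiP in
  [/\ concentrated (m_omega omega X) (spt (m_omega omega X)),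
      spt (m_omega omega X) = phi_oo @` spt 'm_Xoo &
      forall A : set (ultralimit omega X), Ball A ->
        pushforward 'm_Xoo phi_oo A = m_omega omega X A].
Proof.
move=> phi_oo.
have pushE (A : set (ultralimit omega X)) : Ball A ->
    'm_Xoo (phi_oo @^-1` A) = m_omega omega X A.
  by move=> mA; exact: measure_preimage_phi_infty.
have iso (x y : Xoo) :
    mdist (phi_infty np psiP phiP x) (phi_infty np psiP phiP y) = mdist x y.
  exact: phi_infty_isometry.
have mphi (A : set (ultralimit omega X)) : Ball A ->
    measurable (phi_oo @^-1` A : set (borel Xoo)).
  move=> mA; rewrite -[X in measurable X]setTI.
  exact: (measurable_phi_infty np psiP phiP).
have ball_Ball (z : ultralimit omega X) (r : R) : Ball (ball z r).
  by apply: sub_sigma_algebra; exists z, r.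
have mspt : measurable (spt 'm_Xoo : set (borel Xoo)).
  by apply: closed_borel; exact: spt_closed.
have sptE : spt (m_omega omega X) = phi_oo @` spt 'm_Xoo.
  apply/seteqP; split=> [z zs|_ [x xs <-] r r0].
    apply: (isometry_image_closed iso); first exact: spt_closed.
    (* If [ball z e] missed the image of the support, its preimage would lie in the null complement
       of the support, against the positive mass of the ball. *)
    move=> e e0; apply: contrapT => none.
    have := zs e e0; rewrite -pushE// lt0e => /andP[/negP + _]; apply.
    rewrite eq_le measure_ge0 andbT -(measure_setC_spt 'm_Xoo).
    apply: le_measure; rewrite ?inE; [exact: mphi|exact: measurableC|].
    move=> x zx xs; apply: none; exists x => //.
  rewrite -pushE//; have -> : phi_oo @^-1` ball (phi_oo x) r = ball (x : Xoo) r.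
    by apply/seteqP; split=> y; rewrite /preimage /= !ballEmdist /= iso.
  exact: xs.
split=> //.
have mS : Ball (~` spt (m_omega omega X)).
  by rewrite sptE; exact: (Ball_setC_isometry_image iso (@spt_closed _ _ _)).
(* The preimage of the complement of the image of the support avoids that support, so it is null. *)
split=> //; rewrite -pushE//; apply/eqP; rewrite eq_le measure_ge0 andbT.
rewrite -(measure_setC_spt 'm_Xoo).
apply: le_measure; rewrite ?inE; [exact: mphi|exact: measurableC|].
by move=> x; rewrite sptE => nx xs; apply: nx; exists x.
Qed.
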